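(* Let $\Lambda$ be an artin algebra, $n$ a positive integer and $\mathcal{M}$ an $n$-cluster tilting subcategory of $\mathrm{mod}\text{-}\Lambda$. The functor $\Psi:\mathcal{S}(\mathcal{M})\to\mathrm{mod}\text{-}\underline{\mathcal{M}}$, which sends a monomorphism $M_1\xrightarrow{f}M_2$ in $\mathcal{M}$ to $\mathrm{Coker}(\mathcal{M}(-,M^{n-1})\to\mathcal{M}(-,M^n))$, where $$0\to M_1\xrightarrow{f}M_2\to M^1\to\cdots\to M^{n-1}\to M^n\to 0$$ is an $n$-exact sequence in $\mathcal{M}$ completing $f$ (with $M^0:=M_2$), is full, dense and objective.
   Context: $\mathrm{mod}\text{-}\Lambda$ is the category of finitely generated $\Lambda$-modules; all subcategories are full. A full additive subcategory $\mathcal{M}$ of $\mathrm{mod}\text{-}\Lambda$ is $n$-cluster tilting if it is functorially finite (every module has a right and a left $\mathcal{M}$-approximation), generating-cogenerating (every module is a quotient of an object of $\mathcal{M}$ and embeds in an object of $\mathcal{M}$), and $$\mathcal{M}=\{A: \mathrm{Ext}^i_\Lambda(\mathcal{M},A)=0,\ 0<i<n\}=\{A: \mathrm{Ext}^i_\Lambda(A,\mathcal{M})=0,\ 0<i<n\}.$$ $\mathcal{S}(\mathcal{M})$ is the category whose objects are monomorphisms $f:M_1\to M_2$ of $\Lambda$-modules with $M_1,M_2\in\mathcal{M}$, and whose morphisms are commutative squares. $\mathcal{M}(-,M)=\mathrm{Hom}_\Lambda(-,M)|_{\mathcal{M}}$. $\mathrm{mod}\text{-}\underline{\mathcal{M}}$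 is the category of finitely presented additive contravariant functors $\mathcal{M}\to\mathrm{Ab}$ that vanish on projective $\Lambda$-modules. A sequence $0\to X^0\to X^1\to\cdots\to X^{n+1}\to 0$ in $\mathcal{M}$ is $n$-exact if for every $M\in\mathcal{M}$ both $0\to\mathcal{M}(M,X^0)\to\cdots\to\mathcal{M}(M,X^{n+1})$ and $0\to\mathcal{M}(X^{n+1},M)\to\cdots\to\mathcal{M}(X^0,M)$ are exact. Every monomorphism in an $n$-cluster tilting subcategory $\mathcal{M}$ can be completed on the right to an $n$-exact sequence, unique up to homotopy equivalence, so $\Psi$ is well defined on objects; a morphism $(\alpha_1,\alpha_2):f\to f'$ in $\mathcal{S}(\mathcal{M})$ lifts to a morphism of $n$-exact sequences (unique up to homotopy), and $\Psi(\alpha_1,\alpha_2)$ is the induced map of cokernels. An additive functor $F:\mathcal{X}\to\mathcal{Y}$ between additive categories is objective if every morphism $f$ in $\mathcal{X}$ with $F(f)=0$ factors through an object $K$ with $F(K)=0$. *)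

(* Defs.v *)
From HB Require Import structures.
From mathcomp Require Import all_boot all_algebra.
From mathcomp Require Import boolp.

Set Implicit Arguments.
Unset Strict Implicit.
Unset Printing Implicit Defensive.

Import GRing.Theory.
Local Open Scope ring_scope.

(* The group structure on the hom-sets is given by fields instead of a zmodType:
   natural transformations between functors on a category of modules live in a
   larger universe than the carriers of modules. *)
Record preadd := Preadd {
  ob :> Type;
  hom : ob -> ob -> Type;
  idm : forall A, hom A A;
  comp : forall A B C, hom B C -> hom A B -> hom A C;
  zerom : forall A B, hom A B;
  addm : forall A B, hom A B -> hom A B -> hom A B;
  oppm : forall A B, hom A B -> hom A B;
  comp1m : forall A B (f : hom A B), comp (idm B) f = f;
  compm1 : forall A B (f : hom A B), comp f (idm A) = f;
  compmA : forall A B C D (h : hom C D) (g : hom B C) (f : hom A B),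
    comp h (comp g f) = comp (comp h g) f;
  addmA : forall A B (f g h : hom A B), addm f (addm g h) = addm (addm f g) h;
  addmC : forall A B (f g : hom A B), addm f g = addm g f;
  add0m : forall A B (f : hom A B), addm (zerom A B) f = f;
  addNm : forall A B (f : hom A B), addm (oppm f) f = zerom A B;
  compDm : forall A B C (g h : hom B C) (f : hom A B),
    comp (addm g h) f = addm (comp g f) (comp h f);
  compmD : forall A B C (h : hom B C) (f g : hom A B),
    comp h (addm f g) = addm (comp h f) (comp h g) }.

Arguments idm {p} A.
Arguments comp {p A B C} g f : rename.
Arguments zerom {p A B}.
Arguments addm {p A B} f g : rename.
Arguments oppm {p A B} f : rename.

Notation "g '\;o' f" := (comp g f) (at level 50, left associativity).

Section PreaddTheory.
Variable C : preadd.
Implicit Types A B D : C.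

Lemma addm_cancel A B (f g h : hom A B) : addm h f = addm h g -> f = g.
Proof. by move=> /(congr1 (addm (oppm h))); rewrite !addmA addNm !add0m. Qed.

Lemma addm0 A B (f : hom A B) : addm f zerom = f.
Proof. by rewrite addmC add0m. Qed.

Lemma comp0m A B D (f : hom A B) : (zerom : hom B D) \;o f = zerom.
Proof.
by apply: (@addm_cancel _ _ _ _ (zerom \;o f)); rewrite -compDm add0m addm0.
Qed.

Lemma compm0 A B D (f : hom B D) : f \;o (zerom : hom A B) = zerom.
Proof.
by apply: (@addm_cancel _ _ _ _ (f \;o zerom)); rewrite -compmD add0m addm0.
Qed.

Lemma compNm A B D (g : hom B D) (f : hom A B) :
  oppm g \;o f = oppm (g \;o f).
Proof.
apply: (@addm_cancel _ _ _ _ (g \;o f)).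
by rewrite -compDm ![addm _ (oppm _)]addmC !addNm comp0m.
Qed.

Lemma compmN A B D (g : hom B D) (f : hom A B) :
  g \;o oppm f = oppm (g \;o f).
Proof.
apply: (@addm_cancel _ _ _ _ (g \;o f)).
by rewrite -compmD ![addm _ (oppm _)]addmC !addNm compm0.
Qed.

Lemma addmACA A B (a b c d : hom A B) :
  addm (addm a b) (addm c d) = addm (addm a c) (addm b d).
Proof. by rewrite -!addmA; congr addm; rewrite !addmA (addmC b c). Qed.

End PreaddTheory.

Definition is_iso (C : preadd) (A B : C) (f : hom A B) :=
  exists g : hom B A, g \;o f = idm A /\ f \;o g = idm B.

Definition isomorphic (C : preadd) (A B : C) := exists f : hom A B, is_iso f.

Definition zero_object (C : preadd) (K : C) :=
  forall A : C, (forall f : hom K A, f = zerom) /\ (forall f : hom A K, f = zerom).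

Definition op (C : preadd) : preadd.
Proof.
refine (@Preadd C (fun A B => hom B A) (fun A => idm A)
  (fun A B D g f => f \;o g) (fun A B => zerom)
  (fun A B f g => addm f g) (fun A B f => oppm f) _ _ _ _ _ _ _ _ _) => *.
- exact: compm1.
- exact: comp1m.
- by rewrite compmA.
- exact: addmA.
- exact: addmC.
- exact: add0m.
- exact: addNm.
- exact: compmD.
- exact: compDm.
Defined.

Definition full_sub (C : preadd) (P : C -> Prop) : preadd :=
  @Preadd {A : C | P A} (fun A B => hom (sval A) (sval B))
    (fun A => idm (sval A)) (fun A B D g f => g \;o f) (fun A B => zerom)
    (fun A B f g => addm f g) (fun A B f => oppm f)
    (fun A B f => comp1m f) (fun A B f => compm1 f)
    (fun A B D E h g f => compmA h g f)
    (fun A B f g h => addmA f g h) (fun A B f g => addmC f g)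
    (fun A B f => add0m f) (fun A B f => addNm f)
    (fun A B D g h f => compDm g h f) (fun A B D h f g => compmD h f g).

Record functor (C D : preadd) := Functor {
  fob :> C -> D;
  fmap : forall A B : C, hom A B -> hom (fob A) (fob B);
  fmap1 : forall A, fmap (idm A) = idm (fob A);
  fmap_comp : forall A B E (g : hom B E) (f : hom A B),
    fmap (g \;o f) = fmap g \;o fmap f;
  fmapD : forall A B (f g : hom A B), fmap (addm f g) = addm (fmap f) (fmap g) }.

Arguments fmap {C D} F {A B} f : rename.

Definition full (C D : preadd) (F : functor C D) :=
  forall (A B : C) (g : hom (F A) (F B)), exists f : hom A B, fmap F f = g.

Definition dense (C D : preadd) (F : functor C D) :=
  forall B : D, exists A : C, isomorphic (F A) B.

Definition objective (C D : preadd) (F : functor C D) :=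
  forall (A B : C) (f : hom A B), fmap F f = zerom ->
  exists (K : C) (g : hom A K) (h : hom K B),
    zero_object (F K) /\ f = h \;o g.

Record nattrans (C D : preadd) (F G : functor C D) := NatTrans {
  nt :> forall A : C, hom (F A) (G A);
  nt_nat : forall (A B : C) (f : hom A B), nt B \;o fmap F f = fmap G f \;o nt A }.

Lemma nattrans_eq (C D : preadd) (F G : functor C D) (s t : nattrans F G) :
  (forall A, s A = t A) -> s = t.
Proof.
case: s t => [s sN] [t tN] /= st.
have {}st : s = t by apply: functional_extensionality_dep.
by case: _ / st tN => tN; congr NatTrans; apply: Prop_irrelevance.
Qed.

Section FunctorCategory.
Variables C D : preadd.
Implicit Types F G H : functor C D.

Definition nt_id F : nattrans F F.
Proof. by exists (fun A => idm (F A)) => A B f; rewrite comp1m compm1. Defined.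

Definition nt_comp F G H (t : nattrans G H) (s : nattrans F G) : nattrans F H.
Proof.
by exists (fun A => t A \;o s A) => A B f; rewrite -compmA nt_nat !compmA nt_nat.
Defined.

Definition nt_zero F G : nattrans F G.
Proof. by exists (fun A => zerom) => A B f; rewrite comp0m compm0. Defined.

Definition nt_add F G (s t : nattrans F G) : nattrans F G.
Proof.
by exists (fun A => addm (s A) (t A)) => A B f; rewrite compDm compmD !nt_nat.
Defined.

Definition nt_opp F G (s : nattrans F G) : nattrans F G.
Proof.
by exists (fun A => oppm (s A)) => A B f; rewrite compNm compmN nt_nat.
Defined.

Definition functors : preadd.
Proof.
refine (@Preadd (functor C D) (@nattrans C D) nt_id nt_comp nt_zero nt_add
  nt_opp _ _ _ _ _ _ _ _ _) => *; apply: nattrans_eq => X /=.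
- exact: comp1m.
- exact: compm1.
- exact: compmA.
- exact: addmA.
- exact: addmC.
- exact: add0m.
- exact: addNm.
- exact: compDm.
- exact: compmD.
Defined.

End FunctorCategory.

Record arrow (C : preadd) := Arrow {
  adom : C;
  acod : C;
  amap : hom adom acod }.

Record square (C : preadd) (f f' : arrow C) := Square {
  sq1 : hom (adom f) (adom f');
  sq2 : hom (acod f) (acod f');
  sq_comm : amap f' \;o sq1 = sq2 \;o amap f }.

Lemma square_eq (C : preadd) (f f' : arrow C) (a b : square f f') :
  sq1 a = sq1 b -> sq2 a = sq2 b -> a = b.
Proof.
case: a b => [a1 a2 aC] [b1 b2 bC] /= e1 e2.
by subst; congr Square; apply: Prop_irrelevance.
Qed.

Section ArrowCategory.
Variable C : preadd.
Implicit Types f g h : arrow C.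

Definition sq_id f : square f f.
Proof. by exists (idm _) (idm _); rewrite comp1m compm1. Defined.

Definition sq_comp f g h (b : square g h) (a : square f g) : square f h.
Proof.
exists (sq1 b \;o sq1 a) (sq2 b \;o sq2 a).
by rewrite compmA sq_comm -!compmA sq_comm.
Defined.

Definition sq_zero f g : square f g.
Proof. by exists zerom zerom; rewrite comp0m compm0. Defined.

Definition sq_add f g (a b : square f g) : square f g.
Proof.
exists (addm (sq1 a) (sq1 b)) (addm (sq2 a) (sq2 b)).
by rewrite compmD compDm !sq_comm.
Defined.

Definition sq_opp f g (a : square f g) : square f g.
Proof.
by exists (oppm (sq1 a)) (oppm (sq2 a)); rewrite compmN compNm sq_comm.
Defined.

Definition arrows : preadd.
Proof.
refine (@Preadd (arrow C) (@square C) sq_id sq_comp sq_zero sq_add sq_opp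
  _ _ _ _ _ _ _ _ _) => *; apply: square_eq => /=;
  first [ exact: comp1m | exact: compm1 | exact: compmA | exact: addmA
        | exact: addmC | exact: add0m | exact: addNm | exact: compDm
        | exact: compmD ].
Defined.

End ArrowCategory.

Section LinearZmod.
Variables (R : pzRingType) (X Y : lmodType R).

Lemma linear_ext (f g : {linear X -> Y}) : f =1 g -> f = g.
Proof.
case: f g => [f [[Fa] [Fb] ]] [g [[Ga] [Gb] ]] /= /funext E; subst g.
by congr (GRing.Linear.Pack (GRing.Linear.Class _ _));
   congr (_ _); apply: Prop_irrelevance.
Qed.

Definition linear_zero : {linear X -> Y} := \0.
Definition linear_add (f g : {linear X -> Y}) : {linear X -> Y} := f \+ g.
Definition linear_opp (f : {linear X -> Y}) : {linear X -> Y} := \- f.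

Let addA : associative linear_add.
Proof. by move=> f g h; apply: linear_ext => x /=; rewrite addrA. Qed.
Let addC : commutative linear_add.
Proof. by move=> f g; apply: linear_ext => x /=; rewrite addrC. Qed.
Let add0 : left_id linear_zero linear_add.
Proof. by move=> f; apply: linear_ext => x /=; rewrite add0r. Qed.
Let addN : left_inverse linear_zero linear_opp linear_add.
Proof. by move=> f; apply: linear_ext => x /=; rewrite addNr. Qed.

HB.instance Definition _ := gen_eqMixin {linear X -> Y}.
HB.instance Definition _ := gen_choiceMixin {linear X -> Y}.
HB.instance Definition _ :=
  GRing.isZmodule.Build {linear X -> Y} addA addC add0 addN.
End LinearZmod.

Definition linear_id (R : pzRingType) (X : lmodType R) : {linear X -> X} := idfun.
Definition linear_comp (R : pzRingType) (X Y Z : lmodType R)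
  (g : {linear Y -> Z}) (f : {linear X -> Y}) : {linear X -> Z} := g \o f.

Definition postcomp (R : pzRingType) (A X Y : lmodType R) (h : {linear X -> Y})
  (g : {linear A -> X}) : {linear A -> Y} := linear_comp h g.

Definition precomp (R : pzRingType) (A B X : lmodType R) (u : {linear B -> A})
  (g : {linear A -> X}) : {linear B -> X} := linear_comp g u.

Lemma postcomp_additive (R : pzRingType) (A X Y : lmodType R)
  (h : {linear X -> Y}) : zmod_morphism (@postcomp R A X Y h).
Proof. by move=> g g'; apply: linear_ext => a /=; rewrite raddfB. Qed.

HB.instance Definition _ (R : pzRingType) (A X Y : lmodType R)
    (h : {linear X -> Y}) :=
  GRing.isZmodMorphism.Build {linear A -> X} {linear A -> Y} (@postcomp R A X Y h)
    (postcomp_additive h).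

Lemma precomp_additive (R : pzRingType) (A B X : lmodType R)
  (u : {linear B -> A}) : zmod_morphism (@precomp R A B X u).
Proof. by move=> g g'; apply: linear_ext. Qed.

HB.instance Definition _ (R : pzRingType) (A B X : lmodType R)
    (u : {linear B -> A}) :=
  GRing.isZmodMorphism.Build {linear A -> X} {linear B -> X} (@precomp R A B X u)
    (precomp_additive u).

Definition Mod (R : pzRingType) : preadd.
Proof.
refine (@Preadd (lmodType R) (fun X Y => {linear X -> Y}) (@linear_id R)
  (@linear_comp R) (fun X Y => 0) (fun X Y f g => f + g) (fun X Y f => - f)
  _ _ _ _ _ _ _ _ _) => *.
- by apply: linear_ext.
- by apply: linear_ext.
- by apply: linear_ext.
- exact: addrA.
- exact: addrC.
- exact: add0r.
- exact: addNr.
- by apply: linear_ext.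
- by apply: linear_ext => x /=; rewrite raddfD.
Defined.

Lemma additive_ext (X Y : zmodType) (f g : {additive X -> Y}) : f =1 g -> f = g.
Proof.
case: f g => [f [[Fa]]] [g [[Ga]]] /= /funext E; subst g.
by do 3!congr (_ _); apply: Prop_irrelevance.
Qed.

Definition additive_id (X : zmodType) : {additive X -> X} := idfun.
Definition additive_comp (X Y Z : zmodType)
  (g : {additive Y -> Z}) (f : {additive X -> Y}) : {additive X -> Z} := g \o f.
Definition additive_zero (X Y : zmodType) : {additive X -> Y} := \0.
Definition additive_add (X Y : zmodType) (f g : {additive X -> Y}) :
  {additive X -> Y} := f \+ g.
Definition additive_opp (X Y : zmodType) (f : {additive X -> Y}) :
  {additive X -> Y} := \- f.

Definition Ab : preadd.
Proof.
refine (@Preadd zmodType (fun X Y => {additive X -> Y}) additive_id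
  additive_comp additive_zero additive_add additive_opp
  _ _ _ _ _ _ _ _ _) => *; apply: additive_ext => x //=.
- by rewrite addrA.
- by rewrite addrC.
- by rewrite add0r.
- by rewrite addNr.
- by rewrite raddfD.
Defined.

Definition fin_gen (R : pzRingType) (X : lmodType R) :=
  exists (m : nat) (g : 'I_m -> X),
    forall x, exists c : 'I_m -> R, x = \sum_(i < m) c i *: g i.

Definition is_ideal (k : comPzRingType) (I : k -> Prop) :=
  [/\ I 0, forall x y, I x -> I y -> I (x + y)
    & forall a x, I x -> I (a * x)].

Definition artinian (k : comPzRingType) :=
  forall I : nat -> k -> Prop, (forall i, is_ideal (I i)) ->
  (forall i x, I i.+1 x -> I i x) ->
  exists N, forall i, (N <= i)%N -> forall x, I N x -> I i x.

Definition artin_algebra (k : comPzRingType) (L : algType k) :=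
  artinian k /\ fin_gen L.

Definition surj (X Y : Type) (f : X -> Y) := forall y, exists x, f x = y.

Section Modules.
Variable R : pzRingType.
Implicit Types X Y Z A B P : lmodType R.

Definition projective P :=
  forall X Y (g : {linear X -> Y}) (f : {linear P -> Y}), surj g ->
  exists h : {linear P -> X}, forall p, g (h p) = f p.

Record proj_resolution A := ProjResolution {
  res_ob : nat -> lmodType R;
  res_d : forall i, {linear res_ob i.+1 -> res_ob i};
  res_aug : {linear res_ob 0 -> A};
  res_proj : forall i, projective (res_ob i);
  res_aug_surj : surj res_aug;
  res_exact0 : forall x, res_aug x = 0 <-> exists y, res_d 0 y = x;
  res_exact : forall i x, res_d i x = 0 <-> exists y, res_d i.+1 y = x }.

Definition cocycle A (P : proj_resolution A) B i (f : {linear res_ob P i -> B}) :=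
  forall x, f (res_d P i x) = 0.

Definition coboundary A (P : proj_resolution A) B i :
    {linear res_ob P i -> B} -> Prop :=
  match i with
  | 0 => fun f => forall x, f x = 0
  | j.+1 => fun f => exists g : {linear res_ob P j -> B},
                       forall x, f x = g (res_d P j x)
  end.

(* Ext^i_R(A, B) = 0: the cohomology of Hom_R(P, B) vanishes in degree i, for
   every projective resolution P of A (resolutions always exist, and the
   cohomology does not depend on P). *)
Definition ext_vanishes i A B :=
  forall (P : proj_resolution A) (f : {linear res_ob P i -> B}),
    cocycle f -> coboundary f.

Implicit Types M : lmodType R -> Prop.

Definition additive_subcat M :=
  [/\ forall Z, (forall z : Z, z = 0) -> M Z,
      forall X Y, M X -> M Y -> M (X * Y)%type
    & forall X Y (f : {linear X -> Y}), bijective f -> M X -> M Y].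

Definition right_approx M A X (f : {linear X -> A}) :=
  M X /\ forall Y (g : {linear Y -> A}), M Y ->
    exists h : {linear Y -> X}, forall y, g y = f (h y).

Definition left_approx M A X (f : {linear A -> X}) :=
  M X /\ forall Y (g : {linear A -> Y}), M Y ->
    exists h : {linear X -> Y}, forall a, g a = h (f a).

Definition functorially_finite M :=
  forall A, fin_gen A ->
    (exists X (f : {linear X -> A}), right_approx M f) /\
    (exists X (f : {linear A -> X}), left_approx M f).

Definition generating_cogenerating M :=
  forall A, fin_gen A ->
    (exists X (f : {linear X -> A}), M X /\ surj f) /\
    (exists X (f : {linear A -> X}), M X /\ injective f).

Definition n_cluster_tilting (n : nat) M :=
  [/\ additive_subcat M /\ (forall X, M X -> fin_gen X),
      functorially_finite M,
      generating_cogenerating M,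
      forall A, M A <-> fin_gen A /\
        forall i X, (0 < i < n)%N -> M X -> ext_vanishes i X A
    & forall A, M A <-> fin_gen A /\
        forall i X, (0 < i < n)%N -> M X -> ext_vanishes i A X].

End Modules.

(* Of a sequence X^0 -> ... -> X^(n+1) only the terms of index <= n+1 and the
   maps of index <= n matter. *)
Record seqn (C : preadd) := Seqn {
  sq_ob :> nat -> C;
  sq_d : forall i, hom (sq_ob i) (sq_ob i.+1) }.

Definition n_exact (C : preadd) (n : nat) (X : seqn C) :=
  forall M : C,
  [/\ forall g : hom M (X 0), sq_d X 0 \;o g = zerom -> g = zerom,
      forall i, (i < n)%N -> forall g : hom M (X i.+1),
        sq_d X i.+1 \;o g = zerom <-> exists h : hom M (X i), g = sq_d X i \;o h,
      forall g : hom (X n.+1) M, g \;o sq_d X n = zerom -> g = zerom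
    & forall i, (i < n)%N -> forall g : hom (X i.+1) M,
        g \;o sq_d X i = zerom <->
        exists h : hom (X i.+2) M, g = h \;o sq_d X i.+1].

Section Completion.
Variables (C : preadd) (n : nat).

(* For f : A -> B, the sequence A -f-> B -g-> Y^0 -e-> Y^1 -e-> ... *)
Section Splice.
Variables (f : arrow C) (Y : nat -> C) (g : hom (acod f) (Y 0))
  (e : forall i, hom (Y i) (Y i.+1)).

Definition splice_ob (i : nat) : C :=
  match i with 0 => adom f | 1 => acod f | j.+2 => Y j end.

Definition splice_d (i : nat) : hom (splice_ob i) (splice_ob i.+1) :=
  match i return hom (splice_ob i) (splice_ob i.+1) with
  | 0 => amap f | 1 => g | j.+2 => e j end.

Definition splice : seqn C := Seqn splice_d.
End Splice.

Record completion (f : arrow C) := Completion {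
  cpl_ob : nat -> C;
  cpl_g : hom (acod f) (cpl_ob 0);
  cpl_e : forall i, hom (cpl_ob i) (cpl_ob i.+1);
  cpl_exact : n_exact n (splice cpl_g cpl_e) }.

Definition cpl_seq (f : arrow C) (E : completion f) : seqn C :=
  splice (cpl_g E) (cpl_e E).

Definition lifts (f f' : arrow C) (E : completion f) (E' : completion f')
    (a : square f f') (phi : forall i, hom (cpl_seq E i) (cpl_seq E' i)) :=
  [/\ phi 0 = sq1 a, phi 1 = sq2 a
    & forall i, (i <= n)%N ->
        sq_d (cpl_seq E') i \;o phi i = phi i.+1 \;o sq_d (cpl_seq E) i].

End Completion.

Section Psi.
Variables (R : pzRingType) (M : lmodType R -> Prop).

Definition subcat : preadd := full_sub (C := Mod R) M.

Definition mono_arrow (f : arrow subcat) :=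
  injective (amap f : {linear sval (adom f) -> sval (acod f)}).

Definition S_cat : preadd := full_sub (C := arrows subcat) mono_arrow.

Definition Fun_cat : preadd := functors (op subcat) Ab.

(* M(-, X) *)
Definition rep (X : subcat) : Fun_cat.
Proof.
refine (@Functor (op subcat) Ab
  (fun A => {linear sval A -> sval X} : zmodType)
  (fun A B (u : {linear sval B -> sval A}) =>
     @precomp R _ _ (sval X) u : {additive _ -> _}) _ _ _).
- by move=> A; apply: additive_ext => g; apply: linear_ext.
- by move=> A B D u v; apply: additive_ext => g; apply: linear_ext.
- move=> A B u v; apply: additive_ext => g; apply: linear_ext => b /=.
  by rewrite raddfD.
Defined.

(* M(-, h) *)
Definition rep_hom (X Y : subcat) (h : hom X Y) : hom (rep X) (rep Y).
Proof.
exists (fun A : op subcat =>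
  @postcomp R (sval A) _ _ (h : {linear sval X -> sval Y}) : {additive _ -> _}).
by move=> A B u; apply: additive_ext => g; apply: linear_ext.
Defined.

(* F -t-> G -p-> H -> 0 is exact, i.e. p is a cokernel of t. *)
Definition right_exact (F G H : Fun_cat) (t : hom F G) (p : hom G H) :=
  forall A : subcat,
    let tA : {additive fob F A -> fob G A} := nt t A in
    let pA : {additive fob G A -> fob H A} := nt p A in
    surj pA /\ forall y, pA y = 0 <-> exists x, tA x = y.

Definition fin_presented (F : Fun_cat) :=
  exists (X Y : subcat) (t : hom (rep X) (rep Y)) (p : hom (rep Y) F),
    right_exact t p.

Definition vanishes_on_proj (F : Fun_cat) :=
  forall A : subcat, projective (sval A) ->
  forall x : (fob F A : zmodType), x = 0.

(* mod-\underline{M} *)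
Definition mod_stable : preadd :=
  full_sub (C := Fun_cat) (fun F => fin_presented F /\ vanishes_on_proj F).

(* Psi is determined by choices of n-exact completions only up to isomorphism,
   so it is specified rather than constructed.
   Psi f = Coker (M(-, M^(n-1)) -> M(-, M^n)); in the indexing of the whole
   n-exact sequence, M^(n-1) and M^n are the terms n and n+1. *)
Definition is_Psi (n : nat) (Psi : functor S_cat mod_stable) :=
  exists (E : forall f : S_cat, completion n (sval f))
         (p : forall f : S_cat, @hom Fun_cat (rep (cpl_seq (E f) n.+1)) (sval (Psi f))),
    (forall f, right_exact (rep_hom (sq_d (cpl_seq (E f)) n)) (p f)) /\
    (forall (f f' : S_cat) (a : hom f f'),
      exists phi : forall i, hom (cpl_seq (E f) i) (cpl_seq (E f') i),
        lifts a phi /\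
        @comp Fun_cat _ _ _ (fmap Psi a) (p f) =
        @comp Fun_cat _ _ _ (p f') (rep_hom (phi n.+1))).

End Psi.

(* Main.v *)
(** A mono M1 -> M2 in M is completed to an n-exact sequence by taking left
    M-approximations of successive cokernels, and an epi is completed to the left
    by right M-approximations of successive kernels (finitely generated, since an
    artin algebra is noetherian). In both cases the approximations force enough
    Ext groups to vanish that the last module lies in M, and dimension shifting
    shows that every exact sequence 0 -> X^0 -> ... -> X^(n+1) -> 0 in M is n-exact.
    Everything else is homotopy: by the Yoneda lemma a morphism between cokernel
    functors comes from a map X^(n+1) -> Y^(n+1), which extends downwards to a
    chain map by exactness of M(N, -); a chain map that is null-homotopic at one
    end of an n-exact sequence is so at the other end. Well-definedness and
    fullness use this from the bottom to the top, objectivity from the top to the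
    bottom. For density, vanishing on projectives means that a presentation
    M(-, X) -> M(-, Y) -> F -> 0 comes from an epi X -> Y. *)

From HB Require Import structures.
From mathcomp Require Import all_boot all_algebra.
From mathcomp Require Import boolp classical_sets.
Require Import Defs.

Set Implicit Arguments.
Unset Strict Implicit.
Unset Printing Implicit Defensive.

Import GRing.Theory.
Local Open Scope ring_scope.

(** * Homotopies of n-exact sequences *)

(** Vanishing of Ext is stated for all projective resolutions at once, and only vanishing is ever
    used. No comparison of resolutions is then needed, but for a module without resolutions the
    statement is empty, so every passage from vanishing Ext to an actual lift or extension of maps
    consumes a resolution. Noetherianity provides one for each finitely generated module. Each
    approximation gains one degree of Ext vanishing. At the start none of the degrees 1, ..., n - 1
    is known, so n - 1 approximations are made; this is why the sequences have exactly n + 2 terms.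
    Of a homotopy started at the top, only the two lowest components are retained. They suffice to
    factor a square with zero image through a split monomorphism, and split monomorphisms are sent
    to zero because the retraction contracts the identity at the bottom. The functor involves
    choices of sequences and of cokernels. Its values on morphisms are therefore singled out by a
    relation between squares and natural transformations; uniqueness in this relation gives all the
    functor laws. *)

Section Differences.
Variable C : preadd.
Implicit Types A B D : C.

Definition subm A B (f g : hom A B) := addm f (oppm g).

Lemma subm0P A B (f g : hom A B) : subm f g = zerom <-> f = g.
Proof.
split=> [e|->]; last by rewrite /subm addmC addNm.
by rewrite -[f]addm0 -(addNm g) addmA -/(subm f g) e add0m.
Qed.

Lemma compBm A B D (g h : hom B D) (f : hom A B) :
  subm g h \;o f = subm (g \;o f) (h \;o f).
Proof. by rewrite compDm compNm. Qed.

Lemma compmB A B D (h : hom B D) (f g : hom A B) :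
  h \;o subm f g = subm (h \;o f) (h \;o g).
Proof. by rewrite compmD compmN. Qed.

Lemma submKC A B (f g : hom A B) : addm g (subm f g) = f.
Proof. by rewrite /subm addmA [addm g f]addmC -addmA [addm g _]addmC addNm addm0. Qed.

Lemma subm0 A B (f : hom A B) : subm f zerom = f.
Proof. by rewrite -{2}(submKC f zerom) add0m. Qed.

Lemma submm A B (f : hom A B) : subm f f = zerom.
Proof. exact/subm0P. Qed.

Lemma comp_pasting A A' A'' B B' B'' (s : hom A A') (t : hom A' A'')
    (p : hom B A) (p' : hom B' A') (p'' : hom B'' A'') (u : hom B B') (v : hom B' B'') :
  s \;o p = p' \;o u -> t \;o p' = p'' \;o v ->
  (t \;o s) \;o p = p'' \;o (v \;o u).
Proof. by move=> su tv; rewrite -compmA su compmA tv compmA. Qed.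

Lemma comp_pastingD A A' B B' (s t : hom A A') (p : hom B A) (p' : hom B' A')
    (u v : hom B B') :
  s \;o p = p' \;o u -> t \;o p = p' \;o v ->
  addm s t \;o p = p' \;o addm u v.
Proof. by move=> su tv; rewrite compDm compmD su tv. Qed.

End Differences.

Section Homotopy.
Variables (C : preadd) (n : nat).

Definition chain_map (X Y : seqn C) (phi : forall i, hom (X i) (Y i)) :=
  forall i, (i <= n)%N -> sq_d Y i \;o phi i = phi i.+1 \;o sq_d X i.

Lemma chain_map_id (X : seqn C) : chain_map (fun i => idm (X i)).
Proof. by move=> i _; rewrite comp1m compm1. Qed.

Lemma chain_map_comp (X Y Z : seqn C) (psi : forall i, hom (Y i) (Z i))
    (phi : forall i, hom (X i) (Y i)) :
  chain_map psi -> chain_map phi -> chain_map (fun i => psi i \;o phi i).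
Proof.
by move=> cpsi cphi i le_in; rewrite compmA cpsi // -compmA cphi // compmA.
Qed.

Lemma chain_map_add (X Y : seqn C) (psi phi : forall i, hom (X i) (Y i)) :
  chain_map psi -> chain_map phi -> chain_map (fun i => addm (psi i) (phi i)).
Proof. by move=> cpsi cphi i le_in; rewrite compmD compDm cpsi ?cphi. Qed.

(** The top component of a null homotopy. By Yoneda these are exactly the maps that become zero in
    the cokernel of [rep_hom (sq_d Y n)]. *)
Definition top_null (X Y : seqn C) (u : hom (X n.+1) (Y n.+1)) :=
  exists h : hom (X n.+1) (Y n), u = sq_d Y n \;o h.

Lemma n_exact_dd (X : seqn C) i : n_exact n X -> (i < n)%N ->
  sq_d X i.+1 \;o sq_d X i = zerom.
Proof.
move=> /(_ (X i)) [_ /(_ i) ex _ _] lt_in.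
by apply/(ex lt_in); exists (idm _); rewrite compm1.
Qed.

(** If [k] is a homotopy component, [phi i.+1 - d k] vanishes on the differential of [X], and
    contravariant exactness factors it through the next differential: this factor is the next
    component. At the top the difference is zero because the last map of [X] can be cancelled. *)
Lemma null_bottom_top (X Y : seqn C) (phi : forall i, hom (X i) (Y i))
    (h : hom (X 1) (Y 0)) :
  n_exact n X -> n_exact n Y -> chain_map phi ->
  phi 0 = h \;o sq_d X 0 -> top_null (phi n.+1).
Proof.
move=> exX exY cphi phi0.
have H i : (i <= n)%N -> exists k : hom (X i.+1) (Y i),
    subm (phi i.+1) (sq_d Y i \;o k) \;o sq_d X i = zerom.
  elim: i => [|i IHi] le_in.
    by exists h; rewrite compBm -cphi // phi0 compmA submm.
  have [k ek] := IHi (ltnW le_in).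
  have [_ _ _ /(_ i le_in) exXi] := exX (Y i.+1).
  have /exXi [k' ek'] := ek.
  exists k'; rewrite compBm -cphi // -[_ \;o k' \;o _]compmA -ek' compmB.
  by rewrite compmA n_exact_dd // comp0m subm0 submm.
have [k ek] := H n (leqnn n).
by exists k; have [_ _ /(_ _ ek) /subm0P] := exX (Y n.+1).
Qed.

(** Covariant exactness of [Y] builds the homotopy downwards. Both of its lowest components are
    kept, since a morphism of S(M) consists of [phi 0] and [phi 1]. *)
Lemma null_top_bottom (X Y : seqn C) (phi : forall i, hom (X i) (Y i)) :
  (0 < n)%N -> n_exact n X -> n_exact n Y -> chain_map phi ->
  top_null (phi n.+1) ->
  exists (h0 : hom (X 1) (Y 0)) (h1 : hom (X 2) (Y 1)),
    phi 0 = h0 \;o sq_d X 0 /\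
    phi 1 = addm (h1 \;o sq_d X 1) (sq_d Y 0 \;o h0).
Proof.
move=> n_gt0 exX exY cphi [hn phin].
have step i (h : hom (X i.+2) (Y i.+1)) : (i < n)%N ->
    sq_d Y i.+1 \;o subm (phi i.+1) (h \;o sq_d X i.+1) = zerom ->
  exists2 h' : hom (X i.+1) (Y i),
    subm (phi i.+1) (h \;o sq_d X i.+1) = sq_d Y i \;o h' &
    sq_d Y i \;o subm (phi i) (h' \;o sq_d X i) = zerom.
  move=> lt_in; have [_ /(_ i lt_in) exYi _ _] := exY (X i.+1).
  case/exYi => h' eh'; exists h' => //.
  rewrite compmB cphi; last exact: ltnW.
  by rewrite compmA -eh' compBm -compmA n_exact_dd // compm0 subm0 submm.
(* [m] is the distance from the top. The descent stops at index 1; the last step is made separately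
   to keep the equation for [phi 1]. *)
have H m : (m < n)%N -> exists h : hom (X (n - m).+1) (Y (n - m)%N),
    sq_d Y (n - m)%N \;o subm (phi (n - m)%N) (h \;o sq_d X (n - m)%N) = zerom.
  elim: m => [|m IHm] lt_mn.
    rewrite subn0; exists hn.
    by rewrite compmB cphi // compmA -phin submm.
  have [] := IHm (ltnW lt_mn).
  have -> : (n - m = (n - m.+1).+1)%N by rewrite subnSK // ltnW.
  have : (n - m.+1 < n)%N by rewrite ltn_subrL.
  move: (n - m.+1)%N => i lt_in h /(step _ _ lt_in) [h' _ eh'].
  by exists h'.
have [] := H n.-1; first by rewrite ltn_predL.
have ->: (n - n.-1 = 1)%N by rewrite -subn1 subKn.
move=> h1 /(step _ _ n_gt0) [h0 e1 e0]; exists h0, h1; split.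
  have [/(_ _ e0) /subm0P //] := exY (X 0).
by rewrite -e1 submKC.
Qed.

Lemma chain_map_extend (X Y : seqn C) (u : hom (X 0) (Y 0))
    (v : hom (X 1) (Y 1)) :
  n_exact n X -> n_exact n Y -> sq_d Y 0 \;o u = v \;o sq_d X 0 ->
  exists phi : forall i, hom (X i) (Y i),
    [/\ phi 0 = u, phi 1 = v & chain_map phi].
Proof.
move=> exX exY comm0.
have H m : (m <= n)%N -> exists phi : forall i, hom (X i) (Y i),
    [/\ phi 0 = u, phi 1 = v &
      forall i, (i <= m)%N -> sq_d Y i \;o phi i = phi i.+1 \;o sq_d X i].
  elim: m => [|m IHm] le_mn.
    (* The components above 1 are placeholders until the induction overwrites them through
       [dfwith]. *)
    pose phi i : hom (X i) (Y i) :=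
      match i with 0 => u | 1 => v | i.+2 => zerom end.
    by exists phi; split=> // -[].
  have [phi [phi0 phi1 cphi]] := IHm (ltnW le_mn).
  have [_ _ _ /(_ m le_mn) exXm] := exX (Y m.+2).
  have /exXm [w ew] : (sq_d Y m.+1 \;o phi m.+1) \;o sq_d X m = zerom.
    by rewrite -compmA -cphi // compmA n_exact_dd // comp0m.
  exists (dfwith phi w); split; rewrite ?dfwith_out // => i.
  rewrite leq_eqVlt => /predU1P[->|lt_im]; last first.
    by rewrite !dfwith_out ?cphi // gtn_eqF ?ltnS ?lt_im ?(ltnW lt_im).
  by rewrite dfwith_in dfwith_out ?ew // neq_ltn leqnn orbT.
exact: H.
Qed.

Lemma chain_map_of_top (X Y : seqn C) (w : hom (X n.+1) (Y n.+1)) :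
  n_exact n X -> n_exact n Y ->
  (exists v, sq_d Y n \;o v = w \;o sq_d X n) ->
  exists phi : forall i, hom (X i) (Y i), phi n.+1 = w /\ chain_map phi.
Proof.
move=> exX exY [v ev].
have H m : (m <= n)%N -> exists phi : forall i, hom (X i) (Y i),
    phi n.+1 = w /\ forall i, (n - m <= i <= n)%N ->
      sq_d Y i \;o phi i = phi i.+1 \;o sq_d X i.
  elim: m => [|m IHm] le_mn.
    pose T i := hom (X i) (Y i).
    pose phi : forall i, T i := dfwith (fun i => zerom : T i) w.
    exists (dfwith (T := T) phi v).
    have e : dfwith (T := T) phi v n.+1 = w.
      by rewrite dfwith_out ?ltn_eqF // /phi dfwith_in.
    split=> // i; rewrite subn0 => /anti_leq <-.
    by rewrite e dfwith_in.
  have [phi [phin cphi]] := IHm (ltnW le_mn).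
  have le_m : (n - m = (n - m.+1).+1)%N by rewrite subnSK.
  have lt_m : (n - m.+1 < n)%N by rewrite -le_m leq_subr.
  move: (n - m.+1)%N le_m lt_m => j em lt_jn.
  have [_ /(_ j lt_jn) exYj _ _] := exY (X j).
  have /exYj [u eu] : sq_d Y j.+1 \;o (phi j.+1 \;o sq_d X j) = zerom.
    by rewrite compmA cphi ?em ?leqnn // -compmA n_exact_dd // compm0.
  exists (dfwith phi u); split.
    by rewrite dfwith_out // neq_ltn (leqW lt_jn).
  move=> i /andP[]; rewrite leq_eqVlt => /predU1P[<- _|lt_ji le_in].
    by rewrite dfwith_in dfwith_out ?ltn_eqF.
  by rewrite !dfwith_out ?cphi ?em ?lt_ji // ?ltn_eqF ?(leqW lt_ji).
have [phi [phin cphi]] := H n (leqnn n).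
by exists phi; split=> // i le_in; apply: cphi; rewrite subnn.
Qed.

End Homotopy.

(** * Kernels, cokernels and lifting of linear maps *)

Section AdditiveMaps.

Lemma additive_pack (X Y : zmodType) (f : X -> Y) :
  zmod_morphism f -> exists g : {additive X -> Y}, g =1 f.
Proof.
move=> fB; pose F := GRing.isZmodMorphism.Build X Y f fB.
by pose g : {additive X -> Y} := HB.pack f F; exists g.
Qed.

Lemma additive_factor_surj (X Y Z : zmodType) (v : {additive X -> Y})
    (f : {additive X -> Z}) :
  surj v -> (forall x, v x = 0 -> f x = 0) ->
  exists g : {additive Y -> Z}, forall x, g (v x) = f x.
Proof.
move=> /choice[s sK] vf.
have fE x x' : v x = v x' -> f x = f x'.
  by move=> e; apply/subr0_eq; rewrite -raddfB vf // raddfB e subrr.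
have [|g gE] := @additive_pack Y Z (f \o s).
  by move=> y y'; rewrite /= -raddfB; apply: fE; rewrite raddfB !sK.
by exists g => x; rewrite gE /=; apply: fE.
Qed.

Lemma exists_cokernel_additive (X Y : zmodType) (f : {additive X -> Y}) :
  exists (Q : zmodType) (v : {additive Y -> Q}),
    surj v /\ forall y, v y = 0 <-> exists x, f x = y.
Proof.
pose I : {pred Y} := fun y => `[< exists x, f x = y >].
have I_zmod : zmod_closed I.
  split; first by apply/asboolP; exists 0; rewrite raddf0.
  move=> _ _ /asboolP[x <-] /asboolP[y <-]; apply/asboolP.
  by exists (x - y); rewrite raddfB.
pose F := GRing.isZmodClosed.Build Y I I_zmod.
pose J : zmodClosed Y := HB.pack I F.
have vB : zmod_morphism (\pi_(Quotient.quot J)%qT : Y -> Quotient.quot J).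
  exact: raddfB.
have [v vE] := additive_pack vB.
exists (Quotient.quot J), v; split=> [q|y].
  by exists (repr q); rewrite vE reprK.
rewrite vE; split=> [e|yI].
  apply/asboolP; rewrite -[y]subr0 -/(I _) -[I _]/(y - 0 \in J).
  by rewrite Quotient.idealrBE; apply/eqP; rewrite e -vE raddf0.
have : y - 0 \in J by rewrite subr0; apply/asboolP.
by rewrite Quotient.idealrBE => /eqP ->; rewrite -vE raddf0.
Qed.

End AdditiveMaps.

Section LmodOf.
Variables (R : pzRingType) (V : zmodType) (scale : R -> V -> V).
Hypothesis scaleA : forall a b v, scale a (scale b v) = scale (a * b) v.
Hypothesis scale1 : left_id 1 scale.
Hypothesis scaleDr : right_distributive scale +%R.
Hypothesis scaleDl : forall v, {morph scale^~ v : a b / a + b}.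

(** The tuple makes the four laws parameters of the type once the section is closed, so that the
    module instance can be recovered from the type alone. *)
Definition lmod_of : Type := let _ := (scaleA, scale1, scaleDr, scaleDl) in V.
HB.instance Definition _ := GRing.Zmodule.on lmod_of.
HB.instance Definition _ :=
  GRing.Zmodule_isLmodule.Build R lmod_of scaleA scale1 scaleDr scaleDl.

End LmodOf.

Section LinearMaps.
Variable R : pzRingType.
Implicit Types A B C X Y Z P : lmodType R.

Lemma linear_pack X Y (f : X -> Y) :
  linear f -> exists g : {linear X -> Y}, g =1 f.
Proof.
move=> fL; pose F := GRing.isLinear.Build R X Y _ f fL.
by pose g : {linear X -> Y} := HB.pack f F; exists g.
Qed.

Lemma factor_surj X Y Z (v : {linear X -> Y}) (f : {linear X -> Z}) :
  surj v -> (forall x, v x = 0 -> f x = 0) ->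
  exists g : {linear Y -> Z}, forall x, g (v x) = f x.
Proof.
move=> v_surj vf.
have [g0 g0E] := @additive_factor_surj X Y Z v f v_surj vf.
have [|g gE] := @linear_pack Y Z g0.
  move=> a y y'; have [x <-] := v_surj y; have [x' <-] := v_surj y'.
  by rewrite -(linearP v) !g0E; apply: (linearP f).
by exists g => x; rewrite gE g0E.
Qed.

Lemma factor_inj X Y Z (u : {linear X -> Y}) (f : {linear Z -> Y}) :
  injective u -> (forall z, exists x, u x = f z) ->
  exists g : {linear Z -> X}, forall z, u (g z) = f z.
Proof.
move=> u_inj /choice[s sK].
have [|g gE] := @linear_pack Z X s.
  by move=> a z z'; apply: u_inj; rewrite linearP !sK linearP.
by exists g => z; rewrite gE.
Qed.

Section Kernel.
Variables (X Y : lmodType R) (f : {linear X -> Y}).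

Definition in_kernel : {pred X} := fun x => f x == 0.

Lemma in_kernel_submod : subsemimod_closed in_kernel.
Proof.
split; first split.
- by rewrite /in_kernel unfold_in linear0.
- by move=> x y; rewrite !unfold_in linearD => /eqP-> /eqP->; rewrite addr0.
- by move=> a x; rewrite !unfold_in linearZ /= => /eqP->; rewrite scaler0.
Qed.

HB.instance Definition _ :=
  GRing.isSubmodClosed.Build R X in_kernel in_kernel_submod.

Definition kernel := {x : X | x \in in_kernel}.
HB.instance Definition _ := Choice.on kernel.
HB.instance Definition _ := SubType.on kernel.
HB.instance Definition _ := [SubChoice_isSubLmodule of kernel by <:].

Lemma exists_kernel : exists (K : lmodType R) (u : {linear K -> X}),
  injective u /\ forall x, f x = 0 <-> exists a, u a = x.
Proof.
have [|u uE] := @linear_pack kernel X val.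
  by move=> a x y; rewrite linearP.
exists kernel, u; split=> [x y|x].
  by rewrite !uE; apply: val_inj.
split=> [fx|[[a /= aK] <-]]; last by rewrite uE /=; apply/eqP.
have xK : x \in in_kernel by apply/eqP.
by exists (Sub x xK); rewrite uE.
Qed.

End Kernel.

Lemma exists_cokernel X Y (f : {linear X -> Y}) :
  exists (Q : lmodType R) (v : {linear Y -> Q}),
    surj v /\ forall y, v y = 0 <-> exists x, f x = y.
Proof.
have [Q [v [v_surj vE0]]] := @exists_cokernel_additive X Y f.
have {vE0} vE y : v y = 0 <-> exists x, f x = y := vE0 y.
have [s sK] := choice v_surj.
(* The image of [f] is a submodule, so the class of [a *: y] depends only on the class of [y]; this
   lets the section [s] define the action on the quotient group. *)
have vZ a y y' : v y = v y' -> v (a *: y) = v (a *: y').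
  move/eqP; rewrite -subr_eq0 -raddfB => /eqP /vE[x ex].
  apply/eqP; rewrite -subr_eq0 -raddfB -scalerBr -ex; apply/eqP/vE.
  by exists (a *: x); rewrite linearZ.
pose scale a q := v (a *: s q).
have scaleE a y : scale a (v y) = v (a *: y) by apply: vZ; rewrite sK.
have scaleA a b q : scale a (scale b q) = scale (a * b) q.
  by have [y <-] := v_surj q; rewrite !scaleE scalerA.
have scale1 : left_id 1 scale.
  by move=> q; have [y <-] := v_surj q; rewrite !scaleE scale1r.
have scaleDr : right_distributive scale +%R.
  move=> a q q'; have [y <-] := v_surj q; have [y' <-] := v_surj q'.
  by rewrite -raddfD !scaleE scalerDr raddfD.
have scaleDl q : {morph scale^~ q : a b / a + b}.
  by move=> a b; have [y <-] := v_surj q; rewrite !scaleE scalerDl raddfD.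
pose Q' : lmodType R := lmod_of scaleA scale1 scaleDr scaleDl.
have [|v' v'E] := @linear_pack Y Q' v.
  by move=> a y y'; rewrite raddfD -scaleE.
exists Q', v'; split=> [q|y]; last by rewrite v'E; apply: vE.
by have [y <-] := v_surj q; exists y; rewrite v'E.
Qed.

(** The pullback of [g] and [f], realized as the kernel of [(x, p) |-> g x - f p], maps onto [P]; a
    section followed by the first projection is the lift. *)
Lemma projective_lift P X Y (g : {linear X -> Y}) (f : {linear P -> Y}) :
  projective P -> (forall p, exists x, g x = f p) ->
  exists h : {linear P -> X}, forall p, g (h p) = f p.
Proof.
move=> P_proj gf.
have [|r rE] := @linear_pack (X * P)%type Y (fun z => g z.1 - f z.2).
  by move=> a z z'; rewrite /= (linearP g) (linearP f) scalerBr opprD addrACA.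
have [|p1 p1E] := @linear_pack (X * P)%type X fst; first by [].
have [|p2 p2E] := @linear_pack (X * P)%type P snd; first by [].
have [K [u [_ uK]]] := exists_kernel r.
have [|h hK] := P_proj _ _ (linear_comp p2 u) (linear_id P).
  move=> p; have [x ex] := gf p.
  have [|k ek] := (uK (x, p)).1; first by rewrite rE /= ex subrr.
  by exists k; rewrite /= ek p2E.
exists (linear_comp p1 (linear_comp u h)) => p /=.
have := (uK (u (h p))).2 (ex_intro _ _ erefl).
rewrite rE p1E -[(u (h p)).2]p2E => /subr0_eq ->.
by have /= -> := hK p.
Qed.

Lemma projective_prod P P' :
  projective P -> projective P' -> projective (P * P')%type.
Proof.
move=> pP pP' X Y g f g_surj.
have [|i1 i1E] := @linear_pack P (P * P')%type (fun p => (p, 0)).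
  by move=> a p p'; congr pair; rewrite /= scaler0 addr0.
have [|i2 i2E] := @linear_pack P' (P * P')%type (fun p => (0, p)).
  by move=> a p p'; congr pair; rewrite /= scaler0 addr0.
have [h1 h1E] := pP _ _ g (linear_comp f i1) g_surj.
have [h2 h2E] := pP' _ _ g (linear_comp f i2) g_surj.
have [|h hE] := @linear_pack (P * P')%type X (fun z => h1 z.1 + h2 z.2).
  by move=> a z z'; rewrite /= (linearP h1) (linearP h2) scalerDr addrACA.
exists h => -[p p']; rewrite hE (linearD g) h1E h2E /= i1E i2E -(linearD f).
by congr (f (_, _)); rewrite /= ?addr0 ?add0r.
Qed.

Lemma projective_row m : projective 'rV[R]_m.
Proof.
move=> X Y g f g_surj; have [s sK] := choice g_surj.
have [|h hE] := @linear_pack 'rV[R]_m X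
  (fun r => \sum_(i < m) r 0 i *: s (f (delta_mx 0 i))).
  move=> a r r'; rewrite scaler_sumr -big_split; apply: eq_bigr => i _ /=.
  by rewrite !mxE scalerDl scalerA.
exists h => r; rewrite hE linear_sum [in RHS](row_sum_delta r) linear_sum.
by apply: eq_bigr => i _; rewrite !linearZ /= sK.
Qed.

Lemma fin_gen_row X : fin_gen X <->
  exists (m : nat) (g : {linear 'rV[R]_m -> X}), surj g.
Proof.
split=> [[m [g gE]]|[m [g g_surj]]].
  have [|f fE] := @linear_pack 'rV[R]_m X (fun r => \sum_(i < m) r 0 i *: g i).
    move=> a r r'; rewrite scaler_sumr -big_split; apply: eq_bigr => i _ /=.
    by rewrite !mxE scalerDl scalerA.
  exists m, f => x; have [c ->] := gE x.
  by exists (\row_i c i); rewrite fE; apply: eq_bigr => i _; rewrite mxE.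
exists m, (fun i => g (delta_mx 0 i)) => x; have [r <-] := g_surj x.
exists (r 0); rewrite {1}(row_sum_delta r) linear_sum.
by apply: eq_bigr => i _; rewrite linearZ.
Qed.

Lemma fin_gen_surj X Y (f : {linear X -> Y}) : surj f -> fin_gen X -> fin_gen Y.
Proof.
move=> f_surj /fin_gen_row[m [g g_surj]]; apply/fin_gen_row.
exists m, (linear_comp f g) => y.
by have [x <-] := f_surj y; have [r <-] := g_surj x; exists r.
Qed.

Lemma fin_gen_row_self m : fin_gen 'rV[R]_m.
Proof. by apply/fin_gen_row; exists m, (linear_id _) => r; exists r. Qed.

End LinearMaps.

(** * Artin algebras are noetherian *)

Section Span.
Variables (R : pzRingType).
Implicit Types X Y : lmodType R.

(** Peeling off one generator at a time, instead of using an indexed sum, makes the later arguments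
    plain inductions on the list. *)
Fixpoint span X (s : seq X) (x : X) : Prop :=
  if s is y :: s' then exists a, span s' (x - a *: y) else x = 0.

Definition submod X (S : X -> Prop) :=
  [/\ S 0, forall x y, S x -> S y -> S (x + y) & forall a x, S x -> S (a *: x)].

Definition fg_submod X (S : X -> Prop) :=
  exists2 s : seq X, (forall y, y \in s -> S y) & forall x, S x -> span s x.

Lemma submodB X (S : X -> Prop) x y : submod S -> S x -> S y -> S (x - y).
Proof.
by case=> _ SD SZ Sx Sy; apply: SD => //; rewrite -scaleN1r; apply: SZ.
Qed.

Lemma span_submod X (s : seq X) : submod (span s).
Proof.
elim: s => [|y s [s0 sD sZ]] /=; split=> //.
- by move=> x x' -> ->; rewrite addr0.
- by move=> a x ->; rewrite scaler0.
- by exists 0; rewrite scale0r subr0.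
- move=> x x' [a xa] [a' xa']; exists (a + a').
  by rewrite scalerDl opprD addrACA; apply: sD.
- move=> b x [a xa]; exists (b * a).
  by rewrite -scalerA -scalerBr; apply: sZ.
Qed.

Lemma span_cat X (s t : seq X) x y :
  span s x -> span t y -> span (s ++ t) (x + y).
Proof.
elim: s x => [x ->|z s IHs x /= [a xa]] ty; first by rewrite add0r.
by exists a; rewrite addrAC; apply: IHs.
Qed.

Lemma fin_gen_span X : fin_gen X <-> exists s : seq X, forall x, span s x.
Proof.
split=> [[m [g gE]]|[s sX]].
  exists [seq g i | i <- index_enum 'I_m] => x; have [c ->] := gE x.
  elim: (index_enum _) => [|i r IHr]; first by rewrite big_nil.
  by exists (c i); rewrite big_cons addrAC subrr add0r.
exists (size s), (fun i => s`_i) => x.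
have {sX} := sX x; elim: s x => [x ->|y s IHs x /= [a /IHs[c xE]]].
  by exists (fun=> 0); rewrite big_ord0.
exists (fun i => if unlift ord0 i is Some j then c j else a).
rewrite big_ord_recl unlift_none /=.
under eq_bigr => i _ do rewrite liftK.
by rewrite -xE addrC subrK.
Qed.

(* For the graph T of a linear map this says that an extension of finitely
   generated modules is finitely generated. *)
Lemma fg_submod_ext X Y (T : X -> Y -> Prop) :
  submod (fun z : (X * Y)%type => T z.1 z.2) ->
  fg_submod (fun y => exists x, T x y) -> fg_submod (T^~ 0) ->
  fg_submod (fun x => exists y, T x y).
Proof.
move=> subT; have [T0 TD TZ] := subT.
have TB x y x' y' : T x y -> T x' y' -> T (x - x') (y - y').
  by move=> Txy Txy'; apply: (submodB (x := (x, y)) (y := (x', y')) subT).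
case=> sY sY_im spanY [sK sK_T spanK].
have [sX sX_dom liftX] : exists2 s : seq X, (forall x, x \in s -> exists y, T x y) &
    forall y, span sY y -> exists2 x, span s x & T x y.
  elim: sY sY_im {spanY} => [|y sY IHs] sY_im.
    by exists [::] => // y /= ->; exists 0.
  have [x Txy] := sY_im y (mem_head _ _).
  have [|s s_dom lift_s] := IHs.
    by move=> z zs; apply: sY_im; rewrite inE zs orbT.
  exists (x :: s) => [x'|y' /= [a /lift_s[x' sx' Tx']]].
    by rewrite inE => /predU1P[->|/s_dom //]; exists y.
  exists (x' + a *: x); first by exists a; rewrite addrK.
  by rewrite -(subrK (a *: y) y'); apply: (TD (_, _) (_, _) Tx'); apply: (TZ _ (_, _)).
exists (sX ++ sK) => [x|x [y Txy]].
  by rewrite mem_cat => /orP[/sX_dom //|/sK_T]; exists 0.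
have [x' sx' Txy'] := liftX y (spanY y (ex_intro _ x Txy)).
rewrite -(subrK x' x) addrC; apply: span_cat => //; apply: spanK.
by rewrite -(subrr y); apply: TB.
Qed.

End Span.

Section ArtinianNoetherian.
Variable k : comPzRingType.
Hypothesis k_art : artinian k.

Definition fg_ideal (I : k -> Prop) := fg_submod (I : k^o -> Prop).

(** Otherwise a choice function assigns to every ideal satisfying [Q] a strictly smaller one, and
    iterating it from [I0] contradicts the descending chain condition. *)
Lemma exists_minimal_ideal (Q : (k -> Prop) -> Prop) (I0 : k -> Prop) :
  is_ideal I0 -> Q I0 ->
  exists2 I, is_ideal I /\ Q I &
    forall J, is_ideal J -> Q J -> (forall x, J x -> I x) -> forall x, I x -> J x.
Proof.
move=> idI0 QI0; apply: contrapT => nomin.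
pose T := {I | is_ideal I /\ Q I}.
have [f fP] : {f : T -> T & forall I : T,
    (forall x, sval (f I) x -> sval I x) /\ exists x, sval I x /\ ~ sval (f I) x}.
  apply: (@choice T T (fun I J => (forall x, sval J x -> sval I x) /\
    exists x, sval I x /\ ~ sval J x)) => -[I [idI QI]] /=.
  apply: contrapT => noJ.
  apply: nomin; exists I => // J idJ QJ JI x Ix.
  apply: contrapT => nJx; apply: noJ.
  by exists (exist _ J (conj idJ QJ)); split=> //; exists x.
pose I i := iter i f (exist _ I0 (conj idI0 QI0)).
have [i||N /(_ N.+1 (leqnSn N)) stab] := k_art (I := fun i => sval (I i)).
- by case: (svalP (I i)).
- by move=> i x; have [H _] := fP (I i); apply: H.
have [_ [x [xN]]] := fP (I N).
by apply; apply: stab.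
Qed.

(* A minimal ideal I that is not finitely generated satisfies a I = I or a I = 0
   for each a, so it is a vector space over the field k / ann I all of whose
   proper subspaces are finitely generated; but it has a subspace of
   codimension one. *)
Lemma artinian_noetherian (I : k -> Prop) : is_ideal I -> fg_ideal I.
Proof.
move=> idI; apply: contrapT => nfgI.
have [{nfgI idI}I [idI nfgI] minI] :=
  exists_minimal_ideal (Q := fun I => ~ fg_ideal I) idI nfgI.
have [I0 ID IM] := idI.
have minI' J : is_ideal J -> (forall x, J x -> I x) ->
    fg_ideal J \/ forall x, I x -> J x.
  move=> idJ JI; have [|nfgJ] := pselect (fg_ideal J); [by left|right].
  exact: minI.
(* By minimality [a I] is finitely generated or all of [I]. The annihilator [K] of [a] in [I] is
   proper, hence finitely generated; if [a I] were too, [I] would be an extension of one by the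
   other. *)
have divI a : (exists2 x, I x & a * x <> 0) ->
    forall x, I x -> exists2 y, I y & x = a * y.
  case=> x0 Ix0 ax0; pose J x := exists2 y, I y & x = a * y.
  have idJ : is_ideal J.
    split; first by exists 0; rewrite ?mulr0.
      by move=> _ _ [x Ix ->] [y Iy ->]; exists (x + y); rewrite ?mulrDr; first exact: ID.
    by move=> b _ [x Ix ->]; exists (b * x); rewrite 1?mulrCA; first exact: IM.
  have [|fgJ|//] := minI' J idJ; first by move=> _ [x Ix ->]; apply: IM.
  pose K x := I x /\ a * x = 0.
  have [||fgK|IK] := minI' K; last by have [_ /ax0] := IK x0 Ix0.
  - split; first by split; rewrite ?mulr0.
      by move=> x y [Ix ax] [Iy ay]; split; [apply: ID|rewrite mulrDr ax ay addr0].
    by move=> b x [Ix ax]; split; [apply: IM|rewrite mulrCA ax mulr0].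
  - by move=> x [].
  case: nfgI; pose T (x y : k^o) := I x /\ y = a * x.
  have [|||s sI spanI] := @fg_submod_ext k k^o k^o T.
  - split; first by split; rewrite ?mulr0.
      by move=> z z' [Iz ez] [Iz' ez']; split; [apply: ID|rewrite /= mulrDr -ez -ez'].
    by move=> b z [Iz ez]; split; [apply: IM|rewrite /= ez; apply: mulrCA].
  - case: fgJ => s sJ spanJ; exists s => [y /sJ[x Ix ->]|y [x [Ix ->]]].
      by exists x.
    by apply: spanJ; exists x.
  - case: fgK => s sK spanK; exists s => [y /sK[Iy ay]|y [Iy ay]].
      by split.
    by apply: spanK.
  exists s => [y /sI[_ [] //]|x Ix]; apply: spanI; by exists (a * x).
have invI a : (exists2 x, I x & a * x <> 0) ->
    exists b, forall x, I x -> b * (a * x) = x.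
  (* [J i] consists of the elements acting on [I] as multiples of [a ^+ i]. Stability at [N] gives
     [a^N = b a^(N+1)] on [I], and [I = a^N I] cancels [a^N]. *)
  move=> /divI aI; pose J i y := exists c, forall x, I x -> y * x = c * a ^+ i * x.
  have [i||N /(_ N.+1 (leqnSn N) (a ^+ N))] := k_art (I := J).
  - split; first by exists 0 => x _; rewrite !mul0r.
      move=> x y [c xc] [d yd]; exists (c + d) => z Iz.
      by rewrite !mulrDl xc ?yd.
    by move=> b x [c xc]; exists (b * c) => y Iy; rewrite -!mulrA xc ?mulrA.
  - by move=> i x [c xc]; exists (c * a) => y Iy; rewrite xc // exprS mulrA.
  case; first by exists 1 => x _; rewrite mul1r.
  move=> b bE; exists b.
  have aNI i x : I x -> exists2 y, I y & x = a ^+ i * y.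
    elim: i x => [|i IHi] x Ix; first by exists x; rewrite ?mul1r.
    have [x' Ix' ->] := IHi x Ix; have [y Iy ->] := aI x' Ix'.
    by exists y; rewrite ?exprSr ?mulrA.
  by move=> x /(aNI N)[y Iy ->]; rewrite [RHS]bE // exprS !mulrA.
have [x0 Ix0 x0_neq0] : exists2 x, I x & x <> 0.
  apply: contrapT => I_0; case: nfgI; exists [::] => //= x Ix.
  by apply: contrapT => x_neq0; apply: I_0; exists x.
(* Membership of 0 is left out of [good], since the union of the empty chain must satisfy it; [J]
   adds 0 back. *)
pose good (W : set k) := [/\ forall x, W x -> I x,
  forall x y, W x -> W y -> W (x + y), forall a x, W x -> W (a * x) & ~ W x0].
have [F Fgood Ftot|W [[WI WD WM Wx0] Wmax]] := @Zorn_bigcup k good.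
  split=> [x [A FA Ax]|x y [A FA Ax] [B FB By]|a x [A FA Ax]|[A FA Ax]].
  - by have [AI _ _ _] := Fgood A FA; apply: AI.
  - have [AB|BA] := Ftot A B FA FB.
      by exists B => //; have [_ BD _ _] := Fgood B FB; apply: BD => //; apply: AB.
    by exists A => //; have [_ AD _ _] := Fgood A FA; apply: AD => //; apply: BA.
  - by exists A => //; have [_ _ AM _] := Fgood A FA; apply: AM.
  - by have [_ _ _] := Fgood A FA.
pose J x := x = 0 \/ W x.
have JI x : J x -> I x by case=> [->|/WI].
have [J0 JD JM] : is_ideal J.
  split; first by left.
    move=> x y [->|Wx]; first by rewrite add0r.
    by case=> [->|Wy]; [rewrite addr0; right|right; apply: WD].
  by move=> a x [->|Wx]; [left; rewrite mulr0|right; apply: WM].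
have Jx0 : ~ J x0 by case.
have [|//|[s sJ spanJ]|IJ] := minI' J; first by []; last exact/Jx0/IJ.
case: nfgI; exists (x0 :: s) => [y|y Iy /=].
  by rewrite inE => /predU1P[->|/sJ/JI].
suff [c Jc] : exists c, J (y - c * x0) by exists c; apply: spanJ.
have [Jy|nJy] := pselect (J y); first by exists 0; rewrite mul0r subr0.
(* By maximality of [W], [x0] lies in [J + k y]. The coefficient of [y] is invertible on [I], so [y]
   lies in [J + k x0]. *)
pose B z := exists a c, J a /\ z = a + c * y.
have BI z : B z -> I z by case=> a [c [/JI Ia ->]]; apply: ID => //; apply: IM.
have BD z z' : B z -> B z' -> B (z + z').
  case=> a [c [Ja ->]] [a' [c' [Ja' ->]]]; exists (a + a'), (c + c').
  by split; [apply: JD|rewrite mulrDl addrACA].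
have BM b z : B z -> B (b * z).
  case=> a [c [Ja ->]]; exists (b * a), (b * c).
  by split; [apply: JM|rewrite mulrDr mulrA].
have [a [c [Ja x0E]]] : B x0.
  apply: contrapT => nBx0; apply: (Wmax B) => //.
  split=> [z Wz|/(_ y)]; first by exists z, 0; rewrite mul0r addr0; split=> //; right.
  have By : B y by exists 0, 1; rewrite mul1r add0r.
  by move=> /(_ By) Wy; apply: nJy; right.
have [|b bE] := invI c.
  by exists y => // cy; apply: Jx0; rewrite x0E cy addr0.
exists b; rewrite x0E mulrDr bE // opprD addrCA subrr addr0 -mulNr.
exact: JM.
Qed.

(** Induction on the generators of [X]: the coefficients of the first one form an ideal, and the
    elements with coefficient 0 lie in the span of the rest. Coefficients are not unique, so they
    are attached to elements by a relation and not by a map. *)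
Lemma fg_submod_artinian (X : lmodType k) (S : X -> Prop) :
  fin_gen X -> submod S -> fg_submod S.
Proof.
case/fin_gen_span => s sX subS.
have {sX} : forall x, S x -> span s x by move=> x _; apply: sX.
elim: s S subS => [|y s IHs] S subS Ss; first by exists [::] => // y.
have [S0 SD SZ] := subS; have [s0 sD sZ] := span_submod s.
have [T0 TD TZ] : submod (fun z : X * k^o => S z.1 /\ span s (z.1 - z.2 *: y)).
  split; first by split; rewrite ?scale0r ?subr0.
    move=> z z' [Sz sz] [Sz' sz']; split; first exact: SD.
    by rewrite scalerDl opprD addrACA; apply: sD.
  move=> a z [Sz sz]; split; first exact: SZ.
  by rewrite -scalerA -scalerBr; apply: sZ.
have [|||t tS spanT] := @fg_submod_ext k X k^o (fun x a => S x /\ span s (x - a *: y)).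
- by split.
- apply: artinian_noetherian; split.
  + by exists 0.
  + by move=> a b [x Tx] [x' Tx']; exists (x + x'); apply: (TD (_, _) (_, _)).
  + by move=> a b [x Tx]; exists (a *: x); apply: (TZ _ (_, _)).
- apply: IHs => [|x]; last by rewrite scale0r subr0 => -[].
  split; first by split; rewrite ?scale0r ?subr0.
    move=> x x' Tx Tx'; have := TD (x, 0) (x', 0) Tx Tx'.
    by rewrite /= addr0.
  move=> a x Tx; have := TZ a (x, 0) Tx.
  by rewrite /= scaler0.
exists t => [x /tS[a []] //|x Sx]; apply: spanT.
by have [a sa] := Ss x Sx; exists a.
Qed.

End ArtinianNoetherian.

Definition noetherian (R : pzRingType) := forall (K X : lmodType R)
  (u : {linear K -> X}), injective u -> fin_gen X -> fin_gen K.

(** * Restriction of scalars to the base ring *)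

Section RestrictScalars.
Variables (k : comPzRingType) (L : algType k) (X : lmodType L^c).

Definition restr_scale (a : k) (x : X) : X := (a%:A : L^c) *: x.

Lemma restr_scaleA a b x :
  restr_scale a (restr_scale b x) = restr_scale (a * b) x.
Proof.
rewrite /restr_scale scalerA; congr (_ *: _).
(* Products in [L^c] are reversed products in [L]. *)
change (b%:A * a%:A = (a * b)%:A :> L).
by rewrite mulr_algl scalerA mulrC.
Qed.

Lemma restr_scale1 : left_id 1 restr_scale.
Proof. by move=> x; rewrite /restr_scale scale1r (scale1r x). Qed.

Lemma restr_scaleDr : right_distributive restr_scale +%R.
Proof. by move=> a x y; rewrite /restr_scale scalerDr. Qed.

Lemma restr_scaleDl x : {morph restr_scale^~ x : a b / a + b}.
Proof. by move=> a b; rewrite /restr_scale !scalerDl. Qed.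

Definition restr_scalars : lmodType k :=
  lmod_of restr_scaleA restr_scale1 restr_scaleDr restr_scaleDl.

Lemma restr_scaleE (a : k) (g : L) (x : X) :
  restr_scale a ((g : L^c) *: x) = ((a *: g : L) : L^c) *: x.
Proof.
rewrite /restr_scale scalerA; congr (_ *: _).
change (g * a%:A = a *: g :> L).
by rewrite mulr_algr.
Qed.

(** The products [g *: y] of generators of [L] over [k] and of [X] over [L^c] generate. *)
Lemma fin_gen_restr : fin_gen L -> fin_gen X -> fin_gen restr_scalars.
Proof.
move=> /fin_gen_span[gs gsL] /fin_gen_span[ys ysX]; apply/fin_gen_span.
have [t tP] : exists t : seq restr_scalars, forall x : X, span ys x ->
    span t (x : restr_scalars).
  elim: ys {ysX} => [|y ys [t tP]]; first by exists [::].
  exists ([seq ((g : L^c) *: y : restr_scalars) | g <- gs] ++ t) => x /= [a /tP xa].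
  rewrite -(subrK (a *: y) x) [x - _ + _]addrC; apply: span_cat => //.
  move: (a : L) (gsL a) => {gsL} b; elim: gs b => [|g gs IHgs] b /=.
    by move=> ->; rewrite scale0r.
  move=> [c /IHgs bc]; exists c.
  have -> : (b : L^c) *: y - c *: (((g : L^c) *: y) : restr_scalars) =
    ((b - c *: g : L) : L^c) *: y.
    by rewrite [RHS]scalerBl -restr_scaleE.
  exact: bc.
by exists t => x; apply: tP.
Qed.

End RestrictScalars.

(** The image of [K] is a [k]-submodule of a finitely generated [k]-module, and its generators over
    [k] also generate it over [L^c]. *)
Lemma artin_algebra_noetherian (k : comPzRingType) (L : algType k) :
  artin_algebra L -> noetherian L^c.
Proof.
case=> k_art fgL K X u u_inj fgX; apply/fin_gen_span.
pose S (x : restr_scalars X) := exists a, u a = x.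
have [|s sS spanS] := fg_submod_artinian (S := S) k_art (fin_gen_restr fgL fgX).
  split; first by exists 0; rewrite linear0.
    by move=> _ _ [a <-] [b <-]; exists (a + b); rewrite linearD.
  by move=> c _ [a <-]; exists ((c%:A : L^c) *: a); rewrite linearZ.
have {}spanS a : span s (u a : restr_scalars X) by apply: spanS; exists a.
have [t tP] : exists t : seq K, forall a, span s (u a : restr_scalars X) -> span t a.
  elim: s sS {spanS} => [|x s IHs] sS.
    by exists [::] => a /= ua; apply: u_inj; rewrite linear0.
  have [|t tP] := IHs; first by move=> y ys; apply: sS; rewrite inE ys orbT.
  have [b bx] := sS x (mem_head _ _); exists (b :: t) => a /= [c ac].
  exists (c%:A : L^c); apply: tP; move: ac; rewrite -bx.
  have -> : u (a - (c%:A : L^c) *: b) = u a - (c%:A : L^c) *: u b.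
    by rewrite linearB linearZ.
  exact.
by exists t => a; apply: tP.
Qed.

(** * Vanishing of Ext along short exact sequences *)

Section ProductMaps.
Variable R : pzRingType.
Implicit Types X Y Z : lmodType R.

Lemma linear_on_prod X Y Z (f : {linear X -> Z}) (g : {linear Y -> Z}) :
  exists h : {linear (X * Y)%type -> Z}, forall x y, h (x, y) = f x + g y.
Proof.
have [|h hE] := @linear_pack R (X * Y)%type Z (fun z => f z.1 + g z.2).
  by move=> a z z'; rewrite /= (linearP f) (linearP g) scalerDr addrACA.
by exists h => x y; rewrite hE.
Qed.

Lemma linear_to_prod X Y Z (f : {linear Z -> X}) (g : {linear Z -> Y}) :
  exists h : {linear Z -> (X * Y)%type}, forall z, h z = (f z, g z).
Proof.
have [|h hE] := @linear_pack R Z (X * Y)%type (fun z => (f z, g z)).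
  by move=> a z z'; congr pair; rewrite linearP.
by exists h.
Qed.

Lemma linear_prod_split X Y Z (h : {linear (X * Y)%type -> Z}) :
  exists (f : {linear X -> Z}) (g : {linear Y -> Z}),
    forall x y, h (x, y) = f x + g y.
Proof.
have [i1 i1E] := linear_to_prod (linear_id X) (0 : {linear X -> Y}).
have [i2 i2E] := linear_to_prod (0 : {linear Y -> X}) (linear_id Y).
exists (linear_comp h i1), (linear_comp h i2) => x y.
by rewrite /= i1E i2E -linearD; congr (h (_, _)); rewrite /= ?addr0 ?add0r.
Qed.

End ProductMaps.

Section Resolutions.
Variable R : pzRingType.
Implicit Types A B C N X : lmodType R.

Lemma res_dd A (P : proj_resolution A) i x : res_d P i (res_d P i.+1 x) = 0.
Proof. by apply/res_exact; exists x. Qed.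

Lemma res_aug_d A (P : proj_resolution A) x : res_aug P (res_d P 0 x) = 0.
Proof. by apply/res_exact0; exists x. Qed.

Lemma res_lift A (P : proj_resolution A) i (Y Z : lmodType R)
    (g : {linear Y -> Z}) (f : {linear res_ob P i -> Z}) :
  surj g -> exists h : {linear res_ob P i -> Y}, forall p, g (h p) = f p.
Proof. exact: res_proj. Qed.

(** * Resolutions of finitely generated modules *)

Section Existence.
Hypothesis R_noeth : noetherian R.

Definition fgmod := {A : lmodType R | fin_gen A}.

(** One step of a resolution; the kernel is kept in [fgmod] so that the step can be iterated. *)
Record cover (A : fgmod) := Cover {
  cov_ob : lmodType R;
  cov_ker : fgmod;
  cov_map : {linear cov_ob -> sval A};
  cov_inc : {linear sval cov_ker -> cov_ob};
  cov_proj : projective cov_ob;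
  cov_surj : surj cov_map;
  cov_inj : injective cov_inc;
  cov_exact : forall x, cov_map x = 0 <-> exists y, cov_inc y = x }.

Lemma exists_cover (A : fgmod) : inhabited (cover A).
Proof.
have [m [f f_surj]] := (fin_gen_row _).1 (svalP A).
have [K [u [u_inj uK]]] := exists_kernel f.
have fgK := R_noeth u_inj (fin_gen_row_self R m).
constructor; apply: (@Cover A 'rV[R]_m (exist _ K fgK : fgmod) f u) => //.
exact: projective_row.
Qed.

Lemma exists_resolution A : fin_gen A -> inhabited (proj_resolution A).
Proof.
move=> fgA.
have c (B : fgmod) : cover B.
  apply: (sval (cid (P := fun _ : cover B => True) _)).
  by have [c] := exists_cover B; exists c.
pose syz i := iter i (fun B : fgmod => cov_ker (c B)) (exist _ A fgA : fgmod).
constructor; apply: (@ProjResolution R A (fun i => cov_ob (c (syz i)))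
  (fun i => linear_comp (cov_inc (c (syz i))) (cov_map (c (syz i.+1))))
  (cov_map (c (syz 0)))).
- by move=> i; apply: cov_proj.
- exact: (@cov_surj _ (c (syz 0))).
- move=> x; rewrite (cov_exact (c := c (syz 0))); split=> [[y <-]|[y <-]].
    by have [z <-] := cov_surj (c (syz 1)) y; exists z.
  by exists (cov_map (c (syz 1)) y).
- move=> i x; split=> [/= e|[y <-] /=]; last first.
    rewrite (_ : cov_map _ (cov_inc _ _) = 0) ?linear0 //.
    by apply/(cov_exact (c := c (syz i.+1))); eexists.
  have /(cov_exact (c := c (syz i.+1))) [y <-] : cov_map (c (syz i.+1)) x = 0.
    by apply: (@cov_inj _ (c (syz i))); rewrite linear0.
  by have [z <-] := cov_surj (c (syz i.+2)) y; exists z.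
Qed.

End Existence.

Record short_exact A B C (u : {linear A -> B}) (v : {linear B -> C}) : Prop :=
  ShortExact {
    ses_inj : injective u;
    ses_surj : surj v;
    ses_exact : forall b, v b = 0 <-> exists a, u a = b }.

Section ShortExactSequence.
Variables (A B C : lmodType R) (u : {linear A -> B}) (v : {linear B -> C}).
Hypothesis uv : short_exact u v.

Let vu a : v (u a) = 0. Proof. by apply/(ses_exact uv); exists a. Qed.

Let lift_u X (f : {linear X -> B}) : (forall x, v (f x) = 0) ->
  exists g : {linear X -> A}, forall x, u (g x) = f x.
Proof. by move=> vf; apply: factor_inj (ses_inj uv) _ => x; apply/(ses_exact uv). Qed.

Section SecondArgument.
Variable N : lmodType R.

(** Part of the long exact sequence: a lift [f'] of the cocycle to [B] fails to be a cocycle by [g],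
    which represents its image under the connecting map to Ext^(j+2)(N, A). *)
Lemma ext2_quotient j :
  ext_vanishes j.+1 N B -> ext_vanishes j.+2 N A -> ext_vanishes j.+1 N C.
Proof.
move=> extB extA P f f_coc; have [f' f'E] := res_lift f (ses_surj uv).
have [g gE] : exists g : {linear res_ob P j.+2 -> A},
    forall x, u (g x) = f' (res_d P j.+1 x).
  by apply: (lift_u (f := linear_comp f' (res_d P j.+1))) => x /=; rewrite f'E.
have [|g' g'E] := extA P g.
  by move=> x; apply: (ses_inj uv); rewrite gE res_dd !linear0.
have [|h hE] := extB P (f' - linear_comp u g').
  by move=> x /=; rewrite -g'E gE subrr.
exists (linear_comp v h) => x /=.
by rewrite -hE /= linearB vu subr0 f'E.
Qed.

Lemma ext2_sub j :
  ext_vanishes j.+1 N C -> ext_vanishes j.+2 N B -> ext_vanishes j.+2 N A.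
Proof.
move=> extC extB P f f_coc.
have [|g gE] := extB P (linear_comp u f); first by move=> x /=; rewrite f_coc linear0.
have [|h hE] := extC P (linear_comp v g).
  by move=> x /=; rewrite -gE /= vu.
have [h' h'E] := res_lift h (ses_surj uv).
have [|k kE] := lift_u (f := g - linear_comp h' (res_d P j)).
  by move=> x /=; rewrite linearB h'E -hE /= subrr.
exists k => x; apply: (ses_inj uv).
by rewrite kE /= res_dd linear0 subr0 -gE.
Qed.

(** Degree one counterpart of [ext2_sub]: liftability makes the connecting map Hom(N, C) -> Ext^1(N,
    A) vanish. *)
Lemma ext2_sub1 :
  (forall g : {linear N -> C}, exists g' : {linear N -> B}, forall x, v (g' x) = g x) ->
  ext_vanishes 1 N B -> ext_vanishes 1 N A.
Proof.
move=> liftC extB P f f_coc.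
have [|g gE] := extB P (linear_comp u f); first by move=> x /=; rewrite f_coc linear0.
have [|t tE] := factor_surj (f := linear_comp v g) (res_aug_surj P).
  by move=> x /res_exact0[y <-] /=; rewrite -gE /= vu.
have [t' t'E] := liftC t.
have [|k kE] := lift_u (f := g - linear_comp t' (res_aug P)).
  by move=> x /=; rewrite linearB t'E tE /= subrr.
exists k => x; apply: (ses_inj uv).
by rewrite kE /= res_aug_d linear0 subr0 -gE.
Qed.

Lemma ext2_lift (P : proj_resolution N) (g : {linear N -> C}) :
  ext_vanishes 1 N A -> exists g' : {linear N -> B}, forall x, v (g' x) = g x.
Proof.
move=> extA; have [s sE] := res_lift (linear_comp g (res_aug P)) (ses_surj uv).
have [|f fE] := lift_u (f := linear_comp s (res_d P 0)).
  by move=> x /=; rewrite sE /= res_aug_d linear0.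
have [|k kE] := extA P f.
  by move=> x; apply: (ses_inj uv); rewrite fE /= res_dd !linear0.
have [|t tE] := factor_surj (f := s - linear_comp u k) (res_aug_surj P).
  by move=> x /res_exact0[y <-] /=; rewrite -kE fE /= subrr.
exists t => x; have [y <-] := res_aug_surj P x.
by rewrite tE linearB /= vu subr0 sE.
Qed.

End SecondArgument.

(* The middle resolution has terms Q_i * P_i and differential
   (q, p) |-> (d q + twist p, d p). As Q and P are arbitrary, statements about
   the cohomology of every resolution follow without comparing resolutions. *)
Section Horseshoe.
Variables (Q : proj_resolution A) (P : proj_resolution C).

Lemma hs_sigma_subproof : exists s : {linear res_ob P 0 -> B},
  forall p, v (s p) = res_aug P p.
Proof. exact: res_lift (ses_surj uv). Qed.

Definition hs_sigma := sval (cid hs_sigma_subproof).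

Lemma hs_sigmaE p : v (hs_sigma p) = res_aug P p.
Proof. exact: svalP (cid hs_sigma_subproof) p. Qed.

(** The condition for the next twist to exist: [- t d] must lift along [res_d Q i]. The recursion
    carries it along with the map. *)
Definition hs_twist_ok i (t : {linear res_ob P i.+1 -> res_ob Q i}) :=
  forall x, exists y, res_d Q i y = - t (res_d P i.+1 x).

Lemma hs_twist0_subproof : exists t : {linear res_ob P 1 -> res_ob Q 0},
  hs_twist_ok t /\ forall p, u (res_aug Q (t p)) = - hs_sigma (res_d P 0 p).
Proof.
have [|t tE] := projective_lift (P := res_ob P 1) (g := linear_comp u (res_aug Q))
    (f := - linear_comp hs_sigma (res_d P 0)) (@res_proj _ _ P 1).
  move=> p /=; have [a ua] : exists a, u a = - hs_sigma (res_d P 0 p).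
    by apply/(ses_exact uv); rewrite linearN hs_sigmaE res_aug_d oppr0.
  by have [q qE] := res_aug_surj Q a; exists q; rewrite qE.
have {}tE p : u (res_aug Q (t p)) = - hs_sigma (res_d P 0 p) := tE p.
exists t; split=> // x; apply/res_exact0; apply: (ses_inj uv).
by rewrite !linearN tE res_dd !linear0.
Qed.

Lemma hs_twistS_subproof i (t : {linear res_ob P i.+1 -> res_ob Q i}) :
  hs_twist_ok t -> exists t' : {linear res_ob P i.+2 -> res_ob Q i.+1},
  hs_twist_ok t' /\ forall p, res_d Q i (t' p) = - t (res_d P i.+1 p).
Proof.
move=> t_ok; have [t' t'E] := projective_lift (P := res_ob P i.+2) (g := res_d Q i)
    (f := - linear_comp t (res_d P i.+1)) (@res_proj _ _ P i.+2) t_ok.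
exists t'; split=> // x; apply/res_exact.
by rewrite linearN t'E /= res_dd !linear0.
Qed.

Fixpoint hs_twist_rec i : {t : {linear res_ob P i.+1 -> res_ob Q i} | hs_twist_ok t} :=
  match i with
  | 0 => exist _ (sval (cid hs_twist0_subproof)) (svalP (cid hs_twist0_subproof)).1
  | j.+1 => let c := cid (hs_twistS_subproof (svalP (hs_twist_rec j))) in
            exist _ (sval c) (svalP c).1
  end.

Definition hs_twist i := sval (hs_twist_rec i).

Lemma hs_twist0E p : u (res_aug Q (hs_twist 0 p)) = - hs_sigma (res_d P 0 p).
Proof. exact: (svalP (cid hs_twist0_subproof)).2. Qed.

Lemma hs_twistSE i p : res_d Q i (hs_twist i.+1 p) = - hs_twist i (res_d P i.+1 p).
Proof. exact: (svalP (cid (hs_twistS_subproof (svalP (hs_twist_rec i))))).2. Qed.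

Definition hs_ob i : lmodType R := (res_ob Q i * res_ob P i)%type.

Lemma hs_d_subproof i : exists d : {linear hs_ob i.+1 -> hs_ob i},
  forall q p, d (q, p) = (res_d Q i q + hs_twist i p, res_d P i p).
Proof.
have [f fE] := linear_on_prod (res_d Q i) (hs_twist i).
have [g gE] := linear_on_prod (0 : {linear res_ob Q i.+1 -> res_ob P i}) (res_d P i).
have [d dE] := linear_to_prod f g.
by exists d => q p; rewrite dE fE gE add0r.
Qed.

Definition hs_d i := sval (cid (hs_d_subproof i)).

Lemma hs_dE i q p : hs_d i (q, p) = (res_d Q i q + hs_twist i p, res_d P i p).
Proof. exact: svalP (cid (hs_d_subproof i)) q p. Qed.

Lemma hs_aug_subproof : exists e : {linear hs_ob 0 -> B},
  forall q p, e (q, p) = u (res_aug Q q) + hs_sigma p.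
Proof. exact: (linear_on_prod (linear_comp u (res_aug Q)) hs_sigma). Qed.

Definition hs_aug := sval (cid hs_aug_subproof).

Lemma hs_augE q p : hs_aug (q, p) = u (res_aug Q q) + hs_sigma p.
Proof. exact: svalP (cid hs_aug_subproof) q p. Qed.

Lemma hs_aug_surj : surj hs_aug.
Proof.
move=> b; have [p pE] := res_aug_surj P (v b).
have /(ses_exact uv)[a aE] : v (b - hs_sigma p) = 0.
  by rewrite linearB hs_sigmaE pE subrr.
have [q qE] := res_aug_surj Q a.
by exists (q, p); rewrite hs_augE qE aE subrK.
Qed.

Lemma hs_exact0 z : hs_aug z = 0 <-> exists y, hs_d 0 y = z.
Proof.
split=> [|[[q p] <-]]; last first.
  by rewrite hs_dE hs_augE !linearD res_aug_d linear0 add0r hs_twist0E addNr.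
case: z => q p; rewrite hs_augE => qp0.
have /res_exact0[p' p'E] : res_aug P p = 0.
  by rewrite -hs_sigmaE -[RHS](linear0 v) -qp0 linearD vu add0r.
have /res_exact0[q' q'E] : res_aug Q (q - hs_twist 0 p') = 0.
  apply: (ses_inj uv).
  by rewrite !linearB hs_twist0E opprK p'E qp0 linear0.
by exists (q', p'); rewrite hs_dE q'E subrK p'E.
Qed.

Lemma hs_exact i z : hs_d i z = 0 <-> exists y, hs_d i.+1 y = z.
Proof.
split=> [|[[q p] <-]]; last first.
  by rewrite !hs_dE linearD !res_dd add0r hs_twistSE addNr.
case: z => q p; rewrite hs_dE => -[qp0 /res_exact[p' p'E]].
have /res_exact[q' q'E] : res_d Q i (q - hs_twist i.+1 p') = 0.
  by rewrite linearB hs_twistSE opprK p'E.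
by exists (q', p'); rewrite hs_dE q'E subrK p'E.
Qed.

Definition horseshoe : proj_resolution B :=
  @ProjResolution R B hs_ob hs_d hs_aug
    (fun i => projective_prod (@res_proj _ _ Q i) (@res_proj _ _ P i))
    hs_aug_surj hs_exact0 hs_exact.

End Horseshoe.

Section FirstArgument.
Variable X : lmodType R.

(** Extended by 0, the cocycle on [P] has a primitive [(g1, g2)] on the horseshoe. Its part [g1] is
    a cocycle on [Q], hence [h d], and subtracting [h] after the twist from [g2] corrects the
    primitive. *)
Lemma ext1_quotient j (Q : proj_resolution A) :
  ext_vanishes j.+1 A X -> ext_vanishes j.+2 B X -> ext_vanishes j.+2 C X.
Proof.
move=> extA extB P f f_coc; pose T := horseshoe Q P.
have [F FE] := linear_on_prod (0 : {linear res_ob Q j.+2 -> X}) f.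
have [|g gE] := extB T F.
  by case=> q p; rewrite hs_dE FE /= add0r f_coc.
have [g1 [g2 g12E]] := linear_prod_split g.
have {gE} gE q p : f p = g1 (res_d Q j.+1 q + hs_twist Q P j.+1 p) + g2 (res_d P j.+1 p).
  by rewrite -g12E -hs_dE -gE FE add0r.
have [|h hE] := extA Q g1.
  move=> q; have := gE q 0.
  by rewrite !linear0 !addr0.
exists (g2 - linear_comp h (hs_twist Q P j)) => p.
by rewrite (gE 0) linear0 add0r hE hs_twistSE linearN addrC.
Qed.

Lemma ext1_quotient1 (Q : proj_resolution A) :
  (forall f : {linear A -> X}, exists g : {linear B -> X}, forall a, g (u a) = f a) ->
  ext_vanishes 1 B X -> ext_vanishes 1 C X.
Proof.
move=> extendA extB P f f_coc; pose T := horseshoe Q P.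
have [F FE] := linear_on_prod (0 : {linear res_ob Q 1 -> X}) f.
have [|g gE] := extB T F.
  by case=> q p; rewrite hs_dE FE /= add0r f_coc.
have [g1 [g2 g12E]] := linear_prod_split g.
have {gE} gE q p : f p = g1 (res_d Q 0 q + hs_twist Q P 0 p) + g2 (res_d P 0 p).
  by rewrite -g12E -hs_dE -gE FE add0r.
have [|t tE] := factor_surj (f := g1) (res_aug_surj Q).
  move=> _ /res_exact0[q <-]; have := gE q 0.
  by rewrite !linear0 !addr0.
have [h hE] := extendA t.
exists (g2 - linear_comp h (hs_sigma P)) => p.
by rewrite (gE 0) linear0 add0r -tE -hE hs_twist0E linearN addrC.
Qed.

(** The connecting map sends [f] to the class of [f] after the twist. A primitive [g] of that makes
    [(f, - g)] a cocycle on the horseshoe. *)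
Lemma ext1_sub j (P : proj_resolution C) :
  ext_vanishes j.+2 C X -> ext_vanishes j.+1 B X -> ext_vanishes j.+1 A X.
Proof.
move=> extC extB Q f f_coc; pose T := horseshoe Q P.
have [|g gE] := extC P (linear_comp f (hs_twist Q P j.+1)).
  move=> p /=; have := f_coc (hs_twist Q P j.+2 p).
  by rewrite hs_twistSE linearN => /eqP; rewrite oppr_eq0 => /eqP.
have [F FE] := linear_on_prod f (- g).
have [|h hE] := extB T F.
  by case=> q p; rewrite hs_dE FE linearD f_coc add0r /= -gE subrr.
have [h1 [h2 h12E]] := linear_prod_split h.
exists h1 => q; have := hE (q, 0).
by rewrite FE hs_dE h12E !linear0 !addr0.
Qed.

(** [B] is a quotient of [A * res_ob P 0] through [w], so it suffices to extend [f] to the product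
    by some [k] that kills the kernel of [w]; the vanishing of Ext^1 provides [k]. *)
Lemma ext1_extend (P : proj_resolution C) (f : {linear A -> X}) :
  ext_vanishes 1 C X -> exists g : {linear B -> X}, forall a, g (u a) = f a.
Proof.
move=> extC.
have [|a aE] := lift_u (f := linear_comp (hs_sigma P) (res_d P 0)).
  by move=> p /=; rewrite hs_sigmaE res_aug_d.
have [|k kE] := extC P (linear_comp f a).
  move=> p /=; rewrite -[RHS](linear0 f); congr (f _).
  by apply: (ses_inj uv); rewrite aE /= res_dd !linear0.
have [w wE] := linear_on_prod u (hs_sigma P).
have [F FE] := linear_on_prod f k.
have [||g gE] := factor_surj (v := w) (f := F).
- move=> b; have [p pE] := res_aug_surj P (v b).
  have /(ses_exact uv)[a' a'E] : v (b - hs_sigma P p) = 0.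
    by rewrite linearB hs_sigmaE pE subrr.
  by exists (a', p); rewrite wE a'E subrK.
- case=> a' p; rewrite wE FE => e.
  have /res_exact0[q qE] : res_aug P p = 0.
    by rewrite -hs_sigmaE -[RHS](linear0 v) -e linearD vu add0r.
  have -> : a' = - a q.
    apply: (ses_inj uv); rewrite linearN aE /= qE.
    by apply/eqP; rewrite -addr_eq0 e.
  by rewrite linearN -qE -kE /= addNr.
by exists g => a'; rewrite -[u a']addr0 -(linear0 (hs_sigma P)) -wE gE FE linear0 addr0.
Qed.

End FirstArgument.

End ShortExactSequence.

End Resolutions.

(** * Exact sequences in an n-cluster tilting subcategory *)

Section ExactSequences.
Variable R : pzRingType.
Implicit Types A B C K N Q : lmodType R.

Definition exact_upto n (T : nat -> lmodType R)
    (t : forall i, {linear T i -> T i.+1}) :=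
  [/\ injective (t 0),
      forall i, (i < n)%N -> forall x, t i.+1 x = 0 <-> exists y, t i y = x
    & surj (t n)].

Definition cons_ob C (T : nat -> lmodType R) (i : nat) : lmodType R :=
  if i is j.+1 then T j else C.

Definition cons_map C (T : nat -> lmodType R) (f : {linear C -> T 0})
    (t : forall i, {linear T i -> T i.+1}) i :
    {linear cons_ob C T i -> cons_ob C T i.+1} :=
  match i with 0 => f | j.+1 => t j end.

Lemma ext_vanishes_zero2 i A B : (forall b : B, b = 0) -> ext_vanishes i A B.
Proof.
move=> B0 P f _; case: i f => [|i] f /=; first by move=> x; apply: B0.
by exists 0 => x; rewrite [LHS]B0 [RHS]B0.
Qed.

(** A resolution of [A] becomes one of [B] by composing its augmentation with [f]. *)
Lemma ext_vanishes_iso1 i A B X (f : {linear A -> B}) :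
  injective f -> surj f -> ext_vanishes i B X -> ext_vanishes i A X.
Proof.
move=> f_inj f_surj extB P g g_coc.
have aug_surj : surj (linear_comp f (res_aug P)).
  by move=> b; have [a <-] := f_surj b; have [x <-] := res_aug_surj P a; exists x.
have exact0 x : linear_comp f (res_aug P) x = 0 <-> exists y, res_d P 0 y = x.
  rewrite -res_exact0 /=; split=> [fx|->]; last by rewrite linear0.
  by apply: f_inj; rewrite linear0.
pose Q := ProjResolution (@res_proj _ _ P) aug_surj exact0 (@res_exact _ _ P).
exact: (extB Q g g_coc).
Qed.

Lemma ext_vanishes_retract2 i N A B (u : {linear A -> B}) (v : {linear B -> A}) :
  (forall a, v (u a) = a) -> ext_vanishes i.+1 N B -> ext_vanishes i.+1 N A.
Proof.
move=> uK extB P f f_coc.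
have [|g gE] := extB P (linear_comp u f); first by move=> x /=; rewrite f_coc linear0.
by exists (linear_comp v g) => x; rewrite /= -gE /= uK.
Qed.

Section ExactUpto.
Variables (n : nat) (T : nat -> lmodType R) (t : forall i, {linear T i -> T i.+1}).
Arguments t : clear implicits.
Hypothesis exT : exact_upto n t.

Lemma exact_tt i x : (i < n)%N -> t i.+1 (t i x) = 0.
Proof. by move=> lt_in; have [_ ex _] := exT; apply/(ex i lt_in); exists x. Qed.

(* Dimension shifting: Ext^j(N, ker t_m) = 0 for 0 < j <= n - m. *)
Lemma exact_upto_lift N (P : proj_resolution N) i (g : {linear N -> T i.+1}) :
  (forall i j, (0 < j < n)%N -> ext_vanishes j N (T i)) ->
  (i < n)%N -> (forall x, t i.+1 (g x) = 0) ->
  exists h : {linear N -> T i}, forall x, t i (h x) = g x.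
Proof.
move=> extT lt_in tg; have [t0_inj ex _] := exT.
(* Cuts the sequence into 0 -> ker t_j -> T_j -> ker t_(j+1) -> 0. *)
have to_kernel j K (u : {linear K -> T j.+1}) : (j < n)%N ->
    injective u -> (forall x, t j.+1 x = 0 <-> exists a, u a = x) ->
    exists p : {linear T j -> K}, (forall x, u (p x) = t j x) /\
    forall K' (u' : {linear K' -> T j}), injective u' ->
      (forall x, t j x = 0 <-> exists a, u' a = x) -> short_exact u' p.
  move=> lt_jn u_inj uK.
  have [|p pE] := factor_inj (f := t j) u_inj.
    by move=> x; apply/uK; rewrite exact_tt.
  exists p; split=> // K' u' u'_inj u'K; split=> // [a|x].
    have /(ex j lt_jn)[x xE] : t j.+1 (u a) = 0 by apply/uK; exists a.
    by exists x; apply: u_inj; rewrite pE.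
  rewrite -u'K -pE; split=> [->|up]; first by rewrite linear0.
  by apply: u_inj; rewrite linear0.
have ext_ker j m K (u : {linear K -> T m}) : injective u ->
    (forall x, t m x = 0 <-> exists a, u a = x) ->
    (0 < j)%N -> (j + m <= n)%N -> ext_vanishes j N K.
  elim: m j K u => [|m IHm] j K u u_inj uK j_gt0 le_jmn.
    apply: ext_vanishes_zero2 => a; apply: u_inj; apply: t0_inj.
    by rewrite !linear0; apply/uK; exists a.
  have lt_mn : (m < n)%N by rewrite (leq_trans _ le_jmn) ?leq_addl.
  have [p [_ pses]] := to_kernel _ _ _ lt_mn u_inj uK.
  have [K' [u' [u'_inj u'K]]] := exists_kernel (t m).
  case: j j_gt0 le_jmn => // j _ le_jmn.
  apply: (ext2_quotient (pses _ _ u'_inj u'K)).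
    by apply: extT; rewrite /= (leq_trans _ le_jmn) // addnS ltnS leq_addr.
  by apply: IHm u'_inj u'K _ _ => //; rewrite addSnnS.
have [K [u [u_inj uK]]] := exists_kernel (t i.+1).
have [K' [u' [u'_inj u'K]]] := exists_kernel (t i).
have [p [pE pses]] := to_kernel _ _ _ lt_in u_inj uK.
have [|g' g'E] := factor_inj (f := g) u_inj; first by move=> x; apply/uK.
have [|h hE] := ext2_lift (pses _ _ u'_inj u'K) P g'; first exact: ext_ker u'K _ _.
by exists h => x; rewrite -pE hE g'E.
Qed.

(* Dimension shifting: Ext^j(coker t_k, N) = 0 for 0 < j <= k. *)
Lemma exact_upto_extend N i (g : {linear T i.+1 -> N}) :
  (forall A, fin_gen A -> inhabited (proj_resolution A)) ->
  (forall i, fin_gen (T i)) ->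
  (forall i j, (0 < j < n)%N -> ext_vanishes j (T i) N) ->
  (i < n)%N -> (forall x, g (t i x) = 0) ->
  exists h : {linear T i.+2 -> N}, forall x, h (t i.+1 x) = g x.
Proof.
move=> has_res fgT extT lt_in gt; have [_ ex tn_surj] := exT.
have from_cokernel j Q (v : {linear T j.+1 -> Q}) : (j < n)%N ->
    surj v -> (forall x, v x = 0 <-> exists a, t j a = x) ->
    exists w : {linear Q -> T j.+2}, (forall x, w (v x) = t j.+1 x) /\
    injective w.
  move=> lt_jn v_surj vE.
  have [|w wE] := factor_surj (f := t j.+1) v_surj.
    by move=> x /vE[y <-]; apply: exact_tt.
  exists w; split=> // q q'.
  have [x <-] := v_surj q; have [x' <-] := v_surj q'.
  rewrite !wE => /eqP; rewrite -subr_eq0 -linearB => /eqP/(ex j lt_jn)/vE.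
  by rewrite linearB => /subr0_eq.
have from_cokernel_ses j Q (v : {linear T j.+1 -> Q}) (w : {linear Q -> T j.+2}) Q'
    (v' : {linear T j.+2 -> Q'}) : surj v ->
    (forall x, w (v x) = t j.+1 x) -> injective w ->
    surj v' -> (forall x, v' x = 0 <-> exists a, t j.+1 a = x) -> short_exact w v'.
  move=> v_surj wE w_inj v'_surj v'E; split=> // x; rewrite v'E; split=> [[y <-]|[q <-]].
    by exists (v y).
  by have [y <-] := v_surj q; exists y; rewrite wE.
(* [m] is the distance to the right end, where the cokernel of t_(n-1) is isomorphic to the last
   term. *)
have ext_coker m j k Q (v : {linear T k.+1 -> Q}) : surj v ->
    (forall x, v x = 0 <-> exists a, t k a = x) ->
    (m + k.+1 = n)%N -> (0 < j <= k)%N -> ext_vanishes j Q N.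
  elim: m j k Q v => [|m IHm] j k Q v v_surj vE mkn /andP[j_gt0 le_jk].
    have lt_kn : (k < n)%N by rewrite -mkn.
    have [w [wE w_inj]] := from_cokernel _ _ _ lt_kn v_surj vE.
    apply: ext_vanishes_iso1 w_inj _ _.
      have tk_surj : surj (t k.+1) by rewrite -[k.+1]/(0 + k.+1)%N mkn.
      by move=> z; have [x <-] := tk_surj z; exists (v x); rewrite wE.
    by apply: extT; rewrite j_gt0 (leq_ltn_trans le_jk).
  have lt_kn : (k < n)%N by rewrite -mkn leq_addl.
  have [w [wE w_inj]] := from_cokernel _ _ _ lt_kn v_surj vE.
  have [Q' [v' [v'_surj v'E]]] := exists_cokernel (t k.+1).
  have [P] := has_res Q' (fin_gen_surj v'_surj (fgT _)).
  case: j j_gt0 le_jk => // j _ le_jk.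
  apply: (ext1_sub (from_cokernel_ses _ _ _ _ _ _ v_surj wE w_inj v'_surj v'E) P).
    by apply: IHm v'_surj v'E _ _; rewrite ?addnS -?mkn ?addSn ?addnS.
  by apply: extT; rewrite /= (leq_ltn_trans le_jk).
have [Q [v [v_surj vE]]] := exists_cokernel (t i).
have [w [wE w_inj]] := from_cokernel _ _ _ lt_in v_surj vE.
have [|g' g'E] := factor_surj (f := g) v_surj.
  by move=> x /vE[y <-].
suff [h hE] : exists h : {linear T i.+2 -> N}, forall q, h (w q) = g' q.
  by exists h => x; rewrite -wE hE g'E.
(* For [i.+1 = n] there is no further cokernel, and [w] is itself bijective. *)
have [lt_in1|le_ni] := ltnP i.+1 n.
  have [Q' [v' [v'_surj v'E]]] := exists_cokernel (t i.+1).
  have [P] := has_res Q' (fin_gen_surj v'_surj (fgT _)).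
  have uv := from_cokernel_ses _ _ _ _ _ _ v_surj wE w_inj v'_surj v'E.
  apply: (ext1_extend uv P); apply: (ext_coker (n - i.+2)%N _ _ _ _ v'_surj v'E) => //.
  by rewrite subnK.
have w_surj : surj w.
  have ti_surj : surj (t i.+1) by rewrite (_ : i.+1 = n) //; apply/anti_leq/andP.
  by move=> z; have [x <-] := ti_surj z; exists (v x); rewrite wE.
apply: factor_surj w_surj _ => q wq; rewrite (_ : q = 0) ?linear0 //.
by apply: w_inj; rewrite linear0.
Qed.

End ExactUpto.

End ExactSequences.

(** * Approximation sequences in a cluster tilting subcategory *)

Section ClusterTilting.
Variables (R : pzRingType) (n : nat) (M : lmodType R -> Prop).
Hypotheses (R_noeth : noetherian R) (M_ct : n_cluster_tilting n M).
Implicit Types A B C K N X : lmodType R.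

Let has_res A : fin_gen A -> inhabited (proj_resolution A).
Proof. exact: exists_resolution. Qed.

Lemma ct_fin_gen A : M A -> fin_gen A.
Proof. by case: M_ct => -[_ fgM] _ _ _ _; apply: fgM. Qed.

Lemma ct_ext j A B : M A -> M B -> (0 < j < n)%N -> ext_vanishes j A B.
Proof. by case: M_ct => _ _ _ M2 _ MA /M2[_ extB] jn; apply: extB. Qed.

(** An object of [M] maps onto the free module, which is therefore a retract of it and inherits the
    vanishing of Ext. *)
Lemma ct_row m : M 'rV[R]_m.
Proof.
have [_ _ gen M2 _] := M_ct.
have [[X [f [MX f_surj]]] _] := gen _ (fin_gen_row_self R m).
have [u uK] := projective_row (linear_id _) f_surj.
apply/M2; split=> [|[//|i] N jn MN]; first exact: fin_gen_row_self.
by apply: (ext_vanishes_retract2 (u := u) (v := f)) => //; apply: ct_ext.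
Qed.

Lemma n_exact_of_exact (X : seqn (subcat M)) :
  exact_upto n (T := fun i => sval (X i)) (sq_d X) -> n_exact n X.
Proof.
move=> exX N; have [P] := has_res (ct_fin_gen (svalP N)).
have [X0_inj ex Xn_surj] := exX.
split=> [g gX|i lt_in g|g Xg|i lt_in g].
- apply: linear_ext => x; apply: X0_inj; rewrite [RHS]linear0.
  by have := congr1 (fun h : {linear _ -> _} => h x) gX.
- split=> [gX|[h ->]]; last first.
    by apply: linear_ext => x; apply: (exact_tt exX).
  have [||h hE] := exact_upto_lift exX P (g := g) _ lt_in.
  + by move=> i' j jn; apply: ct_ext (svalP _) (svalP _) jn.
  + by move=> x; have := congr1 (fun h : {linear _ -> _} => h x) gX.
  by exists h; apply: linear_ext => x; rewrite /= hE.
- apply: linear_ext => x; have [y <-] := Xn_surj x.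
  by have := congr1 (fun h : {linear _ -> _} => h y) Xg.
split=> [Xg|[h ->]]; last first.
  apply: linear_ext => x; rewrite /= (exact_tt exX) //; exact: (linear0 h).
have [|||h hE] := exact_upto_extend exX (g := g) has_res _ _ lt_in.
- by move=> i'; apply: ct_fin_gen (svalP _).
- by move=> i' j jn; apply: ct_ext (svalP _) (svalP _) jn.
- by move=> x; have := congr1 (fun h : {linear _ -> _} => h x) Xg.
by exists h; apply: linear_ext => x; rewrite /= hE.
Qed.

(** [m] counts the degrees in which Ext(C, M) is not yet known to vanish. For the cokernel of a left
    approximation, the known degrees shift up by one and the approximation property adds degree 1,
    so [m] drops; at 0 the module lies in [M]. *)
Lemma ct_coresolution m C : (m < n)%N -> fin_gen C ->
  (forall j X, (0 < j)%N -> (j + m < n)%N -> M X -> ext_vanishes j C X) ->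
  exists (T : nat -> lmodType R) (t : forall i, {linear T i -> T i.+1})
    (f : {linear C -> T 0}),
    (forall i, M (T i)) /\ exact_upto m (cons_map f t).
Proof.
elim: m C => [|m IHm] C lt_mn fgC extC.
  have MC : M C.
    have [_ _ _ _ M2] := M_ct; apply/M2; split=> // i X /andP[i_gt0 lt_in] MX.
    by apply: extC; rewrite ?addn0.
  (* Only the term of index 0 matters; the others are filled with [C] because all terms must lie in
     [M]. *)
  exists (fun=> C), (fun=> 0), (linear_id C); split=> //.
  by split=> // x; exists x.
have [_ ff gen _ _] := M_ct.
have [_ [N [u [MN u_ext]]]] := ff C fgC.
have u_inj : injective u.
  have [_ [X [f [MX f_inj]]]] := gen C fgC.
  by have [h hE] := u_ext X f MX; move=> x y e; apply: f_inj; rewrite !hE e.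
have [Q [v [v_surj vE]]] := exists_cokernel u.
have uv : short_exact u v by split.
have [P] := has_res fgC.
have [||T [t [f [MT [f_inj ex t_surj]]]]] := IHm Q (ltnW lt_mn).
- exact: fin_gen_surj v_surj (ct_fin_gen MN).
- case=> [//|[|j]] X _ lt_jmn MX.
    apply: (ext1_quotient1 uv P); last by apply: ct_ext; rewrite // (leq_trans _ lt_mn).
    by move=> g; have [h hE] := u_ext X g MX; exists h.
  apply: (ext1_quotient uv P); last first.
    by apply: ct_ext => //=; rewrite (leq_trans _ lt_jmn) // ltnS leq_addr.
  by apply: extC; rewrite // -addSnnS.
exists (cons_ob N T), (cons_map (linear_comp f v) t), u; split; first by case.
split=> //.
  case=> [_ x|[|i] lt_im x] /=.
  - rewrite -vE; split=> [e|->]; last by rewrite linear0.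
    by apply: f_inj; rewrite linear0.
  - rewrite (ex 0 lt_im x); split=> [[q <-]|[y <-]]; last by exists (v y).
    by have [y <-] := v_surj q; exists y.
  - exact: (ex i.+1 lt_im x).
case: m t_surj {IHm lt_mn extC ex} => //= f_surj x.
by have [q <-] := f_surj x; have [y <-] := v_surj q; exists y.
Qed.

(* The induction prolongs K -> T 0 -> T 1 -> ... at its left end, which shifts
   the index of the last map; Phi carries a property of that map across the
   reindexing. *)
Lemma ct_resolution m l K (T : nat -> lmodType R)
    (t : forall i, {linear T i -> T i.+1}) (f : {linear K -> T 0})
    (Phi : forall X Y : lmodType R, {linear X -> Y} -> Prop) :
  (m + l.+1 = n)%N -> fin_gen K ->
  (forall j X, (0 < j)%N -> (j + m < n)%N -> M X -> ext_vanishes j X K) ->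
  (forall i, M (T i)) -> exact_upto l.+1 (cons_map f t) -> Phi _ _ (t l) ->
  exists (Z : nat -> lmodType R) (z : forall i, {linear Z i -> Z i.+1}),
    [/\ forall i, M (Z i), exact_upto n z & Phi _ _ (z n)].
Proof.
elim: m l K T t f => [|m IHm] l K T t f mln fgK extK MT exT Phit.
  have MK : M K.
    have [_ _ _ M2 _] := M_ct; apply/M2; split=> // i X /andP[i_gt0 lt_in] MX.
    by apply: extK; rewrite ?addn0.
  rewrite -mln; exists (cons_ob K T), (cons_map f t); split=> //; by case.
have [_ ff gen _ _] := M_ct.
have [[N [v [MN v_lift]]] _] := ff K fgK.
have v_surj : surj v.
  have [[X [g [MX g_surj]]] _] := gen K fgK.
  have [h hE] := v_lift X g MX.
  by move=> y; have [x <-] := g_surj y; exists (h x).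
have [K' [u [u_inj uK]]] := exists_kernel v.
have uv : short_exact u v by split.
have [f_inj ex t_surj] := exT.
apply: (IHm l.+1 K' (cons_ob N T) (cons_map (linear_comp f v) t) u) => //.
- by rewrite -mln addSnnS.
- exact: R_noeth u_inj (ct_fin_gen MN).
(* The right approximation kills Ext^1(X, K'); the other degrees are shifted from [K]. *)
- case=> [//|[|j]] X _ lt_jmn MX.
    apply: (ext2_sub1 uv); last first.
      by apply: ct_ext => //=; rewrite -mln addSn addnS.
    by move=> g; have [h hE] := v_lift X g MX; exists h.
  apply: (ext2_sub uv).
    by apply: extK; rewrite // -addSnnS.
  by apply: ct_ext => //=; rewrite (leq_trans _ lt_jmn) // ltnS leq_addr.
- by case.
split=> // -[_ x|[|i] lt_im x] /=.
- rewrite -uK; split=> [e|->]; last by rewrite linear0.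
  by apply: f_inj; rewrite linear0.
- rewrite (ex 0 isT x); split=> [[q <-]|[y <-]]; last by exists (v y).
  by have [y <-] := v_surj q; exists y.
- exact: (ex i.+1 lt_im x).
Qed.

End ClusterTilting.

(** * Finitely presented functors *)

Section FunctorCategory.
Variables (R : pzRingType) (M : lmodType R -> Prop).
Implicit Types (X Y Z A : subcat M) (F G H : Fun_cat M).

(** [ev], [app] and [evmap] display values and components of functors as groups and additive maps,
    which [op] and [Ab] hide. *)
Definition ev F A : zmodType := fob F A.

Definition app F G (p : hom F G) A : {additive ev F A -> ev G A} := nt p A.

Definition evmap F A B (u : hom B A) : {additive ev F A -> ev F B} :=
  @fmap _ _ F A B u.

Lemma app_ext F G (p q : hom F G) : (forall A x, app p A x = app q A x) -> p = q.
Proof. by move=> pq; apply: nattrans_eq => A; apply: additive_ext => x; apply: pq. Qed.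

Lemma app_comp F G H (q : hom G H) (p : hom F G) A x :
  app (q \;o p) A x = app q A (app p A x).
Proof. by []. Qed.

Lemma app_nat F G (p : hom F G) A B (u : hom B A) x :
  app p B (evmap F u x) = evmap G u (app p A x).
Proof.
exact: (congr1 (fun h : {additive ev F A -> ev G B} => h x) (nt_nat p u)).
Qed.

Lemma rep_homE X Y (h : hom X Y) A (g : hom A X) : app (rep_hom h) A g = h \;o g.
Proof. by []. Qed.

Lemma rep_hom_comp X Y Z (g : hom Y Z) (f : hom X Y) :
  rep_hom (g \;o f) = rep_hom g \;o rep_hom f.
Proof. by apply: app_ext => A x; rewrite app_comp !rep_homE compmA. Qed.

Lemma rep_hom_add X Y (g f : hom X Y) :
  rep_hom (addm g f) = addm (rep_hom g) (rep_hom f).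
Proof. by apply: app_ext => A x; rewrite rep_homE compDm. Qed.

Lemma rep_hom_id X : rep_hom (idm X) = idm (rep X).
Proof. by apply: app_ext => A x; rewrite rep_homE comp1m. Qed.

(** Representable functors are projective: by Yoneda it suffices to lift the element [q(idm X)] of
    [F X]. *)
Lemma rep_lift X Y F (p : hom (rep Y) F) (q : hom (rep X) F) :
  (forall A, surj (app p A)) -> exists h : hom X Y, p \;o rep_hom h = q.
Proof.
move=> p_surj; have [h hE] := p_surj X (app q X (idm X)).
exists h; apply: app_ext => A g; rewrite app_comp rep_homE.
have -> : (h : hom X Y) \;o g = evmap (rep Y) (g : hom A X) h by [].
rewrite app_nat hE -app_nat; congr (app q A _).
exact: (comp1m (g : hom A X)).
Qed.

Section RightExact.
Variables (X Y : subcat M) (d : hom X Y) (F : Fun_cat M) (p : hom (rep Y) F).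
Hypothesis dp : right_exact (rep_hom d) p.

Lemma right_exact_surj A : surj (app p A).
Proof. exact: proj1 (dp A). Qed.

Lemma right_exact_exact A y : app p A y = 0 <-> exists x, app (rep_hom d) A x = y.
Proof. exact: proj2 (dp A) y. Qed.

Lemma right_exact_zero : p \;o rep_hom d = zerom.
Proof. by apply: app_ext => A x; apply/right_exact_exact; exists x. Qed.

Lemma right_exact_factor A (w : hom A Y) :
  p \;o rep_hom w = zerom <-> exists v : hom A X, w = d \;o v.
Proof.
split=> [pw|[v ->]]; last first.
  by rewrite rep_hom_comp compmA right_exact_zero comp0m.
have /right_exact_exact[v vE] : app p A w = 0.
  rewrite -[w]compm1 -rep_homE -app_comp pw; exact: erefl.
by exists v.
Qed.

Lemma right_exact_epi G (s s' : hom F G) : s \;o p = s' \;o p -> s = s'.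
Proof.
move=> e; apply: app_ext => A x; have [y <-] := right_exact_surj x.
by rewrite -!app_comp e.
Qed.

Lemma right_exact_univ G (q : hom (rep Y) G) : q \;o rep_hom d = zerom ->
  exists s : hom F G, s \;o p = q.
Proof.
move=> qd.
have sE A : exists s : {additive ev F A -> ev G A}, forall y, s (app p A y) = app q A y.
  apply: additive_factor_surj; first exact: right_exact_surj.
  by move=> y /right_exact_exact[x <-]; rewrite -[LHS](app_comp q (rep_hom d)) qd.
have nat_s (A B : op (subcat M)) (u : hom A B) :
  (sval (cid (sE B)) : hom (fob F B) (fob G B)) \;o fmap F u =
  fmap G u \;o (sval (cid (sE A)) : hom (fob F A) (fob G A)).
  apply: additive_ext => x /=; have [y <-] := right_exact_surj x.
  rewrite (svalP (cid (sE A)) y) -[fmap F u]/(evmap F u) -app_nat.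
  by rewrite (svalP (cid (sE B))) app_nat.
exists (NatTrans nat_s); apply: app_ext => A y.
exact: (svalP (cid (sE A)) y).
Qed.

End RightExact.

Section Cokernel.
Variables (X Y : subcat M) (d : hom X Y).

Let coker A := cid (exists_cokernel_additive (app (rep_hom d) A)).
Let coker_ob A : zmodType := sval (coker A).
Let coker_map A : {additive ev (rep Y) A -> coker_ob A} := sval (cid (svalP (coker A))).

Let coker_surj A : surj (coker_map A).
Proof. by have [] := svalP (cid (svalP (coker A))). Qed.

Let coker_exact A y : coker_map A y = 0 <-> exists x, app (rep_hom d) A x = y.
Proof. by have [_] := svalP (cid (svalP (coker A))); apply. Qed.

Let coker_fmap_subproof A B (u : hom B A) :
  exists s : {additive coker_ob A -> coker_ob B},
    forall y, s (coker_map A y) = coker_map B (evmap (rep Y) u y).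
Proof.
apply: (additive_factor_surj (f := additive_comp (coker_map B) (evmap (rep Y) u))).
  exact: coker_surj.
move=> y /coker_exact[x <-]; apply/coker_exact; exists (evmap (rep X) u x).
exact: app_nat.
Qed.

Let coker_fmap A B (u : hom B A) := sval (cid (coker_fmap_subproof u)).
Let coker_fmapE A B (u : hom B A) y :
  coker_fmap u (coker_map A y) = coker_map B (evmap (rep Y) u y).
Proof. exact: svalP (cid (coker_fmap_subproof u)) y. Qed.

Lemma exists_coker_functor :
  exists (F : Fun_cat M) (p : hom (rep Y) F), right_exact (rep_hom d) p.
Proof.
unshelve eexists.
  refine (@Functor (op (subcat M)) Ab coker_ob (fun A B u => coker_fmap u) _ _ _).
  - move=> A; apply: additive_ext => x; have [y <-] := coker_surj x.
    by rewrite coker_fmapE /evmap fmap1.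
  - move=> A B D u v; apply: additive_ext => x; have [y <-] := coker_surj x.
    by rewrite /= !coker_fmapE /evmap fmap_comp.
  - move=> A B u v; apply: additive_ext => x; have [y <-] := coker_surj x.
    by rewrite /= !coker_fmapE -raddfD /evmap fmapD.
unshelve eexists.
  exists (fun A => coker_map A) => A B u.
  by apply: additive_ext => y; rewrite /= coker_fmapE.
by move=> A; split; [apply: coker_surj|apply: coker_exact].
Qed.

End Cokernel.

End FunctorCategory.

(** * The functor Psi *)

Section InducedMaps.
Variables (R : pzRingType) (M : lmodType R -> Prop) (n : nat).
Variables (X Y : seqn (subcat M)).
Hypotheses (exX : n_exact n X) (exY : n_exact n Y).
Variables (F G : Fun_cat M) (p : hom (rep (X n.+1)) F) (q : hom (rep (Y n.+1)) G).
Hypotheses (pX : right_exact (rep_hom (sq_d X n)) p).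
Hypotheses (qY : right_exact (rep_hom (sq_d Y n)) q).

Lemma top_nullP (w : hom (X n.+1) (Y n.+1)) :
  q \;o rep_hom w = zerom <-> top_null w.
Proof. exact: right_exact_factor. Qed.

Lemma induced_map (phi : forall i, hom (X i) (Y i)) : chain_map n phi ->
  exists s : hom F G, s \;o p = q \;o rep_hom (phi n.+1).
Proof.
move=> cphi; apply: (right_exact_univ pX).
rewrite -compmA -rep_hom_comp -cphi // rep_hom_comp compmA.
by rewrite (right_exact_zero qY) comp0m.
Qed.

(** Agreement at index 0 alone suffices: the difference is null at the bottom with homotopy 0, hence
    null at the top. *)
Lemma induced_eq (phi psi : forall i, hom (X i) (Y i)) :
  chain_map n phi -> chain_map n psi -> phi 0 = psi 0 ->
  q \;o rep_hom (phi n.+1) = q \;o rep_hom (psi n.+1).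
Proof.
move=> cphi cpsi e0.
have /top_nullP : top_null (subm (phi n.+1) (psi n.+1)).
  apply: (@null_bottom_top _ n _ _ (fun i => subm (phi i) (psi i)) zerom) => //.
    by move=> i le_in; rewrite compmB compBm cphi ?cpsi.
  by rewrite comp0m; apply/subm0P.
by rewrite -{2}(submKC (phi n.+1) (psi n.+1)) rep_hom_add compmD => ->; rewrite addm0.
Qed.

Lemma induced_full (s : hom F G) :
  exists2 phi : forall i, hom (X i) (Y i), chain_map n phi &
    s \;o p = q \;o rep_hom (phi n.+1).
Proof.
have [w wE] := rep_lift (s \;o p) (right_exact_surj qY).
have [|v vE] := (right_exact_factor qY (w \;o sq_d X n)).1.
  by rewrite rep_hom_comp compmA wE -compmA (right_exact_zero pX) compm0.
have [|phi [phin cphi]] := chain_map_of_top (w := w) exX exY.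
  by exists v.
by exists phi; rewrite ?phin.
Qed.

End InducedMaps.

Lemma induced_id (R : pzRingType) (M : lmodType R -> Prop) n (X : seqn (subcat M))
    (F : Fun_cat M) (p : hom (rep (X n.+1)) F) (phi : forall i, hom (X i) (X i)) :
  n_exact n X -> right_exact (rep_hom (sq_d X n)) p -> chain_map n phi ->
  phi 0 = idm (X 0) -> p \;o rep_hom (phi n.+1) = p.
Proof.
move=> exX pX cphi phi0.
have e := induced_eq exX exX pX cphi (chain_map_id (n := n) X) phi0.
by rewrite e rep_hom_id compm1.
Qed.

Section Psi.
Variables (R : pzRingType) (M : lmodType R -> Prop) (n : nat).
Hypotheses (R_noeth : noetherian R) (n_gt0 : (0 < n)%N).
Hypothesis M_ct : n_cluster_tilting n M.

Lemma exists_completion (f : S_cat M) :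
  exists E : completion n (sval f), surj (sq_d (cpl_seq E) n : {linear _ -> _}).
Proof.
case: f => -[A B f] f_inj /=.
have [C [v [v_surj vE]]] := exists_cokernel (f : {linear sval A -> sval B}).
have fgC := fin_gen_surj v_surj (ct_fin_gen M_ct (svalP B)).
have lt_n : (n.-1 < n)%N by rewrite ltn_predL.
have [|T [t [u [MT [u_inj ex t_surj]]]]] := ct_coresolution R_noeth M_ct lt_n fgC.
  (* With [m = n.-1] the required range of degrees is empty. *)
  case=> // j X _; by rewrite addSnnS prednK // ltnNge leq_addl.
pose Y i : subcat M := exist _ (T i) (MT i).
pose g : hom B (Y 0) := linear_comp u v.
pose e i : hom (Y i) (Y i.+1) := t i.
pose X : seqn (subcat M) := splice (f := Arrow f) g e.
have exE : exact_upto n (T := fun i => sval (X i)) (sq_d X).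
  split=> //.
    case=> [_ x|[|i] lt_in x] /=.
    - rewrite -vE; split=> [ux|->]; last by rewrite linear0.
      by apply: u_inj; rewrite linear0.
    - have lt0 : (0 < n.-1)%N by rewrite -ltnS prednK.
      rewrite (ex 0 lt0 x); split=> [[c <-]|[y <-]]; last by exists (v y).
      by have [y <-] := v_surj c; exists y.
    - have lti : (i.+1 < n.-1)%N by rewrite -ltnS prednK.
      exact: (ex i.+1 lti x).
  (* For [n = 1] the last map is [g] itself, so surjectivity of [v] enters too. *)
  case: (n) n_gt0 t_surj => // -[|m] _ //= u_surj x.
  by have [c <-] := u_surj x; have [y <-] := v_surj c; exists y.
pose E : completion n (Arrow f) :=
  Completion (n_exact_of_exact R_noeth M_ct (X := X) exE).
by exists E; have [] := exE.
Qed.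

Lemma cpl_seq_exact (f : arrow (subcat M)) (E : completion n f) : n_exact n (cpl_seq E).
Proof. exact: cpl_exact. Qed.

Lemma lifts_exist (f f' : arrow (subcat M)) (E : completion n f) (E' : completion n f')
    (a : square f f') :
  exists phi : forall i, hom (cpl_seq E i) (cpl_seq E' i), lifts a phi.
Proof.
have [phi [e0 e1 cphi]] := chain_map_extend (X := cpl_seq E) (Y := cpl_seq E')
  (u := sq1 a) (v := sq2 a) (cpl_seq_exact E) (cpl_seq_exact E') (sq_comm a).
by exists phi.
Qed.

(** * Construction of the functor *)

Section Construction.
Variable E : forall f : S_cat M, completion n (sval f).
Hypothesis E_surj : forall f, surj (sq_d (cpl_seq (E f)) n : {linear _ -> _}).

(** The cokernel vanishes on a projective because every map from it to the last term lifts along the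
    surjective last differential. *)
Lemma Psi_ob_subproof (f : S_cat M) : exists F : mod_stable M,
  exists p : @hom (Fun_cat M) (rep (cpl_seq (E f) n.+1)) (sval F),
    right_exact (rep_hom (sq_d (cpl_seq (E f)) n)) p.
Proof.
have [F [p pE]] := exists_coker_functor (sq_d (cpl_seq (E f)) n).
have FP : fin_presented F /\ vanishes_on_proj F.
  split.
    by exists (cpl_seq (E f) n), (cpl_seq (E f) n.+1),
      (rep_hom (sq_d (cpl_seq (E f)) n)), p.
  move=> A A_proj x; have [y <-] := right_exact_surj pE x.
  have [h hE] := A_proj _ _ _ (y : {linear _ -> _}) (E_surj (f := f)).
  by apply/(right_exact_exact pE); exists h; apply: linear_ext => a; apply: hE.
by exists (exist _ F FP), p.
Qed.

Definition Psi_ob f : mod_stable M := sval (cid (Psi_ob_subproof f)).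
Definition Psi_p f : @hom (Fun_cat M) (rep (cpl_seq (E f) n.+1)) (sval (Psi_ob f)) :=
  sval (cid (svalP (cid (Psi_ob_subproof f)))).
Lemma Psi_pE f : right_exact (rep_hom (sq_d (cpl_seq (E f)) n)) (Psi_p f).
Proof. exact: (svalP (cid (svalP (cid (Psi_ob_subproof f))))). Qed.

(** Since [phi] is only unique up to homotopy, the induced map is described by a relation; the
    functor laws follow from its uniqueness and its closure under identities, composition and
    sums. *)
Definition is_induced (f f' : S_cat M) (a : hom f f')
    (s : @hom (Fun_cat M) (sval (Psi_ob f)) (sval (Psi_ob f'))) :=
  exists phi : forall i, hom (cpl_seq (E f) i) (cpl_seq (E f') i),
    lifts a phi /\ s \;o Psi_p f = Psi_p f' \;o rep_hom (phi n.+1).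

Lemma is_induced_uniq f f' (a : hom f f') s s' :
  is_induced a s -> is_induced a s' -> s = s'.
Proof.
case=> phi [[phi0 _ cphi] e] [psi [[psi0 _ cpsi] e']].
apply: (right_exact_epi (Psi_pE f)); rewrite e e'.
apply: (induced_eq (cpl_seq_exact _) (cpl_seq_exact _) (Psi_pE f')) => //.
by rewrite phi0 psi0.
Qed.

Lemma Psi_map_subproof f f' (a : hom f f') : exists s, is_induced a s.
Proof.
have [phi lphi] := lifts_exist (E f) (E f') a; have [_ _ cphi] := lphi.
by have [s sE] := induced_map (Psi_pE f) (Psi_pE f') cphi; exists s, phi.
Qed.

Definition Psi_map f f' (a : hom f f') : hom (Psi_ob f) (Psi_ob f') :=
  sval (cid (Psi_map_subproof a)).

Lemma Psi_mapE f f' (a : hom f f') : is_induced a (Psi_map a).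
Proof. exact: (svalP (cid (Psi_map_subproof a))). Qed.

Lemma is_induced_id f :
  is_induced (idm f : hom f f) (idm (sval (Psi_ob f))).
Proof.
exists (fun i => idm (cpl_seq (E f) i)); split.
  by split; [exact: erefl|exact: erefl|exact: chain_map_id].
by rewrite rep_hom_id (compm1 (Psi_p f)) (comp1m (Psi_p f)).
Qed.

Lemma is_induced_comp f f' f'' (b : hom f' f'') (a : hom f f') t s :
  is_induced b t -> is_induced a s -> is_induced (b \;o a) (t \;o s).
Proof.
case=> psi [[psi0 psi1 cpsi] epsi] [phi [[phi0 phi1 cphi] ephi]].
exists (fun i => psi i \;o phi i); split.
  split; [exact: (f_equal2 comp psi0 phi0)|exact: (f_equal2 comp psi1 phi1)|].
  exact: (chain_map_comp cpsi cphi).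
by rewrite rep_hom_comp; exact: (comp_pasting ephi epsi).
Qed.

Lemma is_induced_add f f' (b a : hom f f') t s :
  is_induced b t -> is_induced a s -> is_induced (addm b a) (addm t s).
Proof.
case=> psi [[psi0 psi1 cpsi] epsi] [phi [[phi0 phi1 cphi] ephi]].
exists (fun i => addm (psi i) (phi i)); split.
  split; [exact: (f_equal2 addm psi0 phi0)|exact: (f_equal2 addm psi1 phi1)|].
  exact: (chain_map_add cpsi cphi).
by rewrite rep_hom_add; exact: (comp_pastingD epsi ephi).
Qed.

Definition Psi_functor : functor (S_cat M) (mod_stable M) :=
  @Functor (S_cat M) (mod_stable M) Psi_ob Psi_map
    (fun f => is_induced_uniq (Psi_mapE _) (is_induced_id f))
    (fun f f' f'' b a => is_induced_uniq (Psi_mapE _)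
       (is_induced_comp (Psi_mapE b) (Psi_mapE a)))
    (fun f f' b a => is_induced_uniq (Psi_mapE _)
       (is_induced_add (Psi_mapE b) (Psi_mapE a))).

Lemma Psi_functorP : is_Psi n Psi_functor.
Proof.
exists E, Psi_p; split; first exact: Psi_pE.
by move=> f f' a; apply: Psi_mapE.
Qed.

End Construction.

Lemma exists_Psi : exists Psi : functor (S_cat M) (mod_stable M), is_Psi n Psi.
Proof.
exists (Psi_functor (fun f => svalP (cid (exists_completion f)))).
exact: Psi_functorP.
Qed.

(** * Fullness, density and objectivity *)

Section Properties.
Variable Psi : functor (S_cat M) (mod_stable M).
Variable E : forall f : S_cat M, completion n (sval f).
Variable p : forall f : S_cat M,
  @hom (Fun_cat M) (rep (cpl_seq (E f) n.+1)) (sval (Psi f)).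
Hypothesis pE : forall f, right_exact (rep_hom (sq_d (cpl_seq (E f)) n)) (p f).
Hypothesis Psi_E : forall (f f' : S_cat M) (a : hom f f'),
  exists phi : forall i, hom (cpl_seq (E f) i) (cpl_seq (E f') i),
    lifts a phi /\
    @comp (Fun_cat M) _ _ _ (fmap Psi a) (p f) =
    @comp (Fun_cat M) _ _ _ (p f') (rep_hom (phi n.+1)).

Lemma Psi_full : full Psi.
Proof.
move=> f f' s.
have exf := cpl_seq_exact (E f); have exf' := cpl_seq_exact (E f').
have [phi cphi sE] := induced_full exf exf' (pE f) (pE f') s.
pose a : hom f f' := Square (cphi 0 (leq0n n)).
exists a; have [psi [[psi0 _ cpsi] aE]] := Psi_E a.
apply: (right_exact_epi (pE f)); rewrite [LHS]aE [RHS]sE.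
by apply: (induced_eq exf exf' (pE f')) => //; rewrite psi0.
Qed.

(** A surjection [g] from a free module [P] to [Y] is an element of [rep Y] at [P]. Its image in
    F(P) = 0 is zero, so [g] factors through [h]. *)
Lemma stable_presentation_surj (F : mod_stable M) (X Y : subcat M) (h : hom X Y)
    (q : @hom (Fun_cat M) (rep Y) (sval F)) :
  right_exact (rep_hom h) q -> surj (h : {linear sval X -> sval Y}).
Proof.
move=> qh y; have [m [g g_surj]] := (fin_gen_row _).1 (ct_fin_gen M_ct (svalP Y)).
pose P : subcat M := exist _ _ (ct_row M_ct m).
have g0 : q \;o rep_hom (g : hom P Y) = zerom.
  have [_ F0] := svalP F.
  apply: app_ext => A z; rewrite app_comp.
  have -> : app (rep_hom (g : hom P Y)) A z =
    evmap (rep Y) (z : hom A P) (g : hom P Y) by [].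
  rewrite app_nat [app q P _](F0 P (@projective_row R m)); exact: raddf0.
have [x <-] := g_surj y.
have [v ->] := (right_exact_factor qh (g : hom P Y)).1 g0.
by exists ((v : {linear _ -> _}) x).
Qed.

Lemma exists_n_exact_presentation (F : mod_stable M) :
  exists (Z : seqn (subcat M)) (q : @hom (Fun_cat M) (rep (Z n.+1)) (sval F)),
    [/\ n_exact n Z, injective (sq_d Z 0 : {linear _ -> _}) &
      right_exact (rep_hom (sq_d Z n)) q].
Proof.
have [[[X MX] [[Y MY] [t [q tq]]]] _] := svalP F.
pose Y' : subcat M := exist _ Y MY.
have [h hE] := rep_lift t (p := idm (rep Y')) (fun A x => ex_intro _ x erefl).
rewrite comp1m in hE; rewrite -{t}hE in tq.
have h_surj := stable_presentation_surj tq.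
have [K [u [u_inj uK]]] := exists_kernel (h : {linear X -> Y}).
pose T i : lmodType R := if i is 0 then X else Y.
pose t i : {linear T i -> T i.+1} := if i is 0 then h else 0.
(* The last map must still present [F] after reindexing. Membership in [M] is quantified here
   because [ct_resolution] speaks of bare modules; proof irrelevance then identifies the
   witnesses. *)
pose Phi (A B : lmodType R) (g : {linear A -> B}) :=
  exists (MA : M A) (MB : M B) (r : @hom (Fun_cat M) (rep (exist _ B MB)) (sval F)),
    right_exact (@rep_hom R M (exist _ A MA) (exist _ B MB) g) r.
have [||||||Z [z [MZ [z0_inj ex z_surj]]]] :=
    @ct_resolution R n M R_noeth M_ct n.-1 0 K T t u Phi.
- by rewrite addn1 prednK.
- exact: R_noeth u_inj (ct_fin_gen M_ct MX).
- by case=> // j N _; rewrite addSnnS prednK // ltnNge leq_addl.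
- by case=> [|i].
- split=> // -[|//] _ x; exact: uK.
- by exists MX, MY, q.
case=> MA; rewrite (Prop_irrelevance MA (MZ n)) {MA} => -[MB].
rewrite (Prop_irrelevance MB (MZ n.+1)) {MB} => -[r rE].
pose Z' : seqn (subcat M) := @Seqn (subcat M) (fun i => exist _ (Z i) (MZ i)) z.
exists Z', r; split=> //.
by apply: (n_exact_of_exact R_noeth M_ct).
Qed.

(** [Psi] uses its own completion of the first map of [Z], not [Z]. The identities on the first two
    terms extend to chain maps in both directions, and these induce inverse isomorphisms of
    cokernels. *)
Lemma Psi_dense : dense Psi.
Proof.
move=> F; have [Z [q [exZ Z0_inj qZ]]] := exists_n_exact_presentation F.
pose f : S_cat M := exist (@mono_arrow R M) (Arrow (sq_d Z 0)) Z0_inj.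
have exf := cpl_seq_exact (E f).
have comm (X Y : subcat M) (g : hom X Y) : g \;o idm X = idm Y \;o g.
  by rewrite comp1m compm1.
have [phi [phi0 _ cphi]] := chain_map_extend exf exZ (comm _ _ (sq_d Z 0)).
have [psi [psi0 _ cpsi]] := chain_map_extend exZ exf (comm _ _ (sq_d Z 0)).
have [s sE] := induced_map (pE f) qZ cphi.
have [t tE] := induced_map qZ (pE f) cpsi.
exists f, s, t; split.
  apply: (right_exact_epi (pE f)).
  rewrite [LHS](comp_pasting sE tE) -rep_hom_comp [RHS](comp1m (p f)).
  apply: (induced_id exf (pE f) (chain_map_comp cpsi cphi)).
  by rewrite psi0 phi0 comp1m.
apply: (right_exact_epi qZ).
rewrite [LHS](comp_pasting tE sE) -rep_hom_comp [RHS](comp1m q).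
apply: (induced_id exZ qZ (chain_map_comp cphi cpsi)).
by rewrite psi0 phi0 comp1m.
Qed.

(** The retraction is a null homotopy of the identity at the bottom, so the identity of the last
    term is null and the epimorphism [p K] is zero. *)
Lemma Psi_split_zero (K : S_cat M) (r : hom (acod (sval K)) (adom (sval K))) :
  r \;o amap (sval K) = idm _ -> zero_object (Psi K).
Proof.
move=> rK; have exK := cpl_seq_exact (E K).
have p0 : p K = zerom.
  rewrite -[p K]compm1 -rep_hom_id; apply/(top_nullP (pE K)).
  exact: (null_bottom_top (X := cpl_seq (E K)) (Y := cpl_seq (E K)) (h := r) exK exK
    (chain_map_id (n := n) _) (esym rK)).
have Psi0 A x : x = 0 :> ev (sval (Psi K)) A.
  by have [y <-] := right_exact_surj (pE K) x; rewrite p0.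
move=> G; split=> s; apply: app_ext => A x.
  by rewrite (Psi0 A x) [LHS]raddf0.
exact: Psi0.
Qed.

(* The null homotopy phi 0 = h0 d0, phi 1 = h1 d1 + d0' h0 factors the square
   through the split monomorphism A -> A * B with A, B the codomains of f, f'. *)
Lemma Psi_objective : objective Psi.
Proof.
move=> f f' a a0; have exf := cpl_seq_exact (E f); have exf' := cpl_seq_exact (E f').
have [phi [[phi0 phi1 cphi] aE]] := Psi_E a.
have phin : top_null (phi n.+1).
  by apply/(top_nullP (pE f')); rewrite -aE a0;
    exact: (@comp0m (Fun_cat M) _ _ (sval (Psi f')) (p f)).
have [h0 [h1 [e0 e1]]] := null_top_bottom n_gt0 exf exf' cphi phin.
rewrite phi0 in e0; rewrite phi1 in e1.
pose A : subcat M := acod (sval f); pose B : subcat M := acod (sval f').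
have [[[_ MP _] _] _ _ _ _] := M_ct.
pose AB : subcat M :=
  @exist (lmodType R) M (sval A * sval B)%type (MP _ _ (svalP A) (svalP B)).
(* The second component of [a] is [k + l], written as [v] after [w] with [w = (1, k)] and [v =
   [l, 1]]. The left square commutes because [k] vanishes on the image of [f], the right one because
   [v i = l]. *)
pose k : hom A B := h1 \;o sq_d (cpl_seq (E f)) 1.
pose l : hom A B := amap (sval f') \;o h0.
have [i iE] := linear_to_prod (linear_id (sval A)) (0 : {linear sval A -> sval B}).
have [r rE] := linear_on_prod (linear_id (sval A)) (0 : {linear sval B -> sval A}).
have [w wE] := linear_to_prod (linear_id (sval A)) (k : {linear sval A -> sval B}).
have [v vE] := linear_on_prod (l : {linear sval A -> sval B}) (linear_id (sval B)).
have ri : (r : hom AB A) \;o (i : hom A AB) = idm A.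
  by apply: linear_ext => x; rewrite /= iE rE addr0.
have i_inj : injective i.
  by move=> x y; rewrite !iE => -[].
pose K : S_cat M := exist (@mono_arrow R M) (Arrow (i : hom A AB)) i_inj.
have comm_g : (i : hom A AB) \;o amap (sval f) = (w : hom A AB) \;o amap (sval f).
  apply: linear_ext => x; rewrite /= iE wE; congr pair.
  have dd := n_exact_dd exf n_gt0.
  have := congr1 (fun u => h1 \;o u) dd; rewrite compm0 compmA => kf.
  by have := congr1 (fun u : {linear _ -> _} => u x) kf.
have comm_h : amap (sval f') \;o h0 = (v : hom AB B) \;o (i : hom A AB).
  by apply: linear_ext => x; rewrite /= iE vE addr0.
pose g : hom f K := @Square _ (sval f) (sval K) (amap (sval f)) (w : hom A AB) comm_g.
pose h : hom K f' := @Square _ (sval K) (sval f') h0 (v : hom AB B) comm_h.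
exists K, g, h; split; first exact: (@Psi_split_zero K r ri).
apply: square_eq; first exact: e0.
rewrite e1; apply: linear_ext => x; rewrite /= wE vE; exact: addrC.
Qed.

End Properties.
End Psi.

(** [is_Psi] leaves the completions and cokernels open, so the properties are proved for every
    realization; the existence part shows that there is one. *)
Theorem theorem4p1 (k : comPzRingType) (L : algType k) (n : nat)
    (M : lmodType L^c -> Prop) :
  artin_algebra L -> (0 < n)%N -> n_cluster_tilting n M ->
  (exists Psi : functor (S_cat M) (mod_stable M), is_Psi n Psi) /\
  (forall Psi : functor (S_cat M) (mod_stable M), is_Psi n Psi ->
     full Psi /\ dense Psi /\ objective Psi).
Proof.
move=> /artin_algebra_noetherian L_noeth n_gt0 M_ct; split.
  exact: exists_Psi L_noeth n_gt0 M_ct.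
move=> Psi [E [p [pE Psi_E]]]; split; first exact: Psi_full pE Psi_E.
split; first exact: (Psi_dense L_noeth n_gt0 M_ct pE).
exact: (Psi_objective n_gt0 M_ct pE Psi_E).
Qed.
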